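(* Let $m>l\ge 0$ be integers, let $C\subset\mathbb{R}^n$ be an irreducible real algebraic variety of dimension $d$, $1\le d<n$, and let $\Sigma_{2m,2l+1}(C)\subset\mathbb{C}^n\times\mathbb{C}^n$ be the variety defined in the context. Let $\Sigma^1_{2m,2l+1}(C)$ be the irreducible component, of dimension $n$, of $\Sigma_{2m,2l+1}(C)$ which contains all the real points of $\Sigma_{2m,2l+1}(C)$. Let $p=\frac{2m}{2l+1}$ and $g(\mathbf{x})=\|\mathbf{x}\|_p^p$ for $\mathbf{x}\in\mathbb{R}^n$, and let $\Omega_{\|\cdot\|_p}(C)$ and $\Sigma_{g,1}(C)$ be as defined in the context. Then $$\Omega_{\|\cdot\|_p}(C)\cap\Sigma_{g,1}(C)\subset\Sigma^1_{2m,2l+1}(C).$$ Hence the projection $\pi:\Sigma^1_{2m,2l+1}(C)\to\mathbb{C}^n$ onto the first $n$ coordinates is dominating, and the $\|\cdot\|_p$-distance degree $\delta_{\|\cdot\|_p}(C)$ is the degree of this dominating map.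
   Context: Varieties. For an irreducible variety $V\subset\mathbb{F}^n$ ($\mathbb{F}=\mathbb{R}$ or $\mathbb{C}$) with vanishing ideal generated by $p_1,\ldots,p_s$, let $D(V)(\mathbf{y})$ be the $n\times s$ matrix whose columns are the gradients of the $p_i$ at $\mathbf{y}$. The dimension $d$ of $V$ is $n-\max_{\mathbf{y}\in V}\mathrm{rank}\,D(V)(\mathbf{y})$. A point $\mathbf{y}\in V$ is smooth if $\mathrm{rank}\,D(V)(\mathbf{y})=n-d$ and singular otherwise; $\mathrm{Sing}\,V$ is the set of singular points. If $V$ is real, its complexification $V_{\mathbb{C}}$ is the common complex zero locus of $p_1,\ldots,p_s$, which is an irreducible complex variety of dimension $d$. For $\mathbf{y}\in C_{\mathbb{C}}\setminus\mathrm{Sing}\,C_{\mathbb{C}}$, $\mathbf{U}(\mathbf{y})\subset\mathbb{C}^n$ is the $(n-d)$-dimensional column space of $D(C_{\mathbb{C}})(\mathbf{y})$. The variety $\Sigma_{2m,2l+1}(C)$. For an odd positive integer $q$ let $\mathbf{F}_q:\mathbb{C}^n\to\mathbb{C}^n$, $\mathbf{F}_q(z_1,\ldots,z_n)=(z_1^q,\ldots,z_n^q)$. Put $$\Sigma_{2m,2l+1,1}(C)=\{(\mathbf{z},\mathbf{y})\in\mathbb{C}^n\times(C_{\mathbb{C}}\setminus\mathrm{Sing}\,C_{\mathbb{C}}):\ \mathbf{F}_{2m-2l-1}(\mathbf{z}-\mathbf{y})\in\mathbf{F}_{2l+1}(\mathbf{U}(\mathbf{y}))\},$$ and let $\Sigma_{2m,2l+1}(C)$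 be its closure in $\mathbb{C}^n\times\mathbb{C}^n$. It is an algebraic variety all of whose irreducible components have dimension $n$, exactly one of which contains all real points (points of $\mathbb{R}^n\times\mathbb{R}^n$) of $\Sigma_{2m,2l+1}(C)$. The paper calls $\Sigma^1_{2m,2l+1}(C)$ the critical point correspondence for the $\ell_p$ norm. Best approximation. For a norm $\nu$ on $\mathbb{R}^n$, $\mathrm{dist}_\nu(\mathbf{x},C)=\min\{\nu(\mathbf{x}-\mathbf{y}):\mathbf{y}\in C\}$, a best $\nu$-approximation of $\mathbf{x}$ is a point of $C$ attaining the minimum, $S(C)$ is the set of $\mathbf{x}\in\mathbb{R}^n$ whose best $\nu$-approximation is not unique, and $\Omega_\nu(C)=\{(\mathbf{x},\mathbf{z}):\mathbf{x}\in\mathbb{R}^n\setminus S(C),\ \mathbf{z}\in C,\ \mathrm{dist}_\nu(\mathbf{x},C)=\nu(\mathbf{x}-\mathbf{z})\}$. Here $\nu=\|\cdot\|_p$, $\|\mathbf{x}\|_p=(\sum_{i=1}^n|x_i|^p)^{1/p}$. Critical points. For $h\in C^1(\mathbb{R}^n)$, $\mathbf{y}\in C$ is a critical point of $h|C$ if $\mathbf{y}\in\mathrm{Sing}\,C$, or $\mathbf{y}\in C\setminus\mathrm{Sing}\,C$ and $\nabla h(\mathbf{y})$ vanishes on the tangent space $T_{\mathbf{y}}C$. With $g_{\mathbf{x}}(\mathbf{y})=g(\mathbf{x}-\mathbf{y})$, put $\Sigma_{g,1}(C)=\{(\mathbf{x},\mathbf{y})\in\mathbb{R}^n\times C:\mathbf{y}\text{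 is a critical point of }g_{\mathbf{x}}|C\}\setminus(\mathbb{R}^n\times\mathrm{Sing}\,C)$. $\nu$-distance degree. Let $\nu$ be a semi-algebraic norm (its graph is semi-algebraic) such that $\nu$ and its dual norm are differentiable away from $\mathbf{0}$. A semi-algebraic set is smooth if it is an open subset of the set of smooth points of an irreducible real algebraic set. Let $\Omega_\nu(C)\setminus(\mathbb{R}^n\times\mathrm{Sing}\,C)=\bigcup_{i=1}^N\Theta_i$ be a smooth semi-algebraic Whitney stratification (finite partition into smooth semi-algebraic sets satisfying the Whitney conditions), where for $i\le M$ the stratum $\Theta_i$ is an open semi-algebraic subset of the set of smooth points of an irreducible $n$-dimensional variety $V_i\subset\mathbb{R}^n\times\mathbb{R}^n$, and $\dim\Theta_i<n$ for $i>M$. Then the projections $\pi:V_{i,\mathbb{C}}\to\mathbb{C}^n$ on the first $n$ coordinates, $i\le M$, are dominating (have Zariski dense image). Order the strata so that $V_1,\ldots,V_k$ ($k\le M$) are the distinct varieties among $V_1,\ldots,V_M$, and let $\delta_i$ be the degree of $\pi:V_{i,\mathbb{C}}\to\mathbb{C}^n$. Then $\delta_\nu(C)=\sum_{i=1}^k\delta_i$. The degree of a dominating regular map between irreducible complex affine varieties of the same dimension is the degree of the corresponding function field extension, equivalently the cardinality of a generic fibre. *)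

(* Defs.v *)
From mathcomp Require Import all_boot all_order all_algebra.
From mathcomp Require Import boolp classical_sets functions cardinality reals.
From mathcomp Require Import topology normedtype derive exp.
From mathcomp Require Import complex.
(* The notations of mpoly clash with those of analysis: [mpoly n K] stands for
   K[X_1, ..., X_n] and [meval (v 0) f] for the value of f at the row vector v. *)
From mathcomp Require Import -(notations) mpoly.

Set Implicit Arguments.
Unset Strict Implicit.
Unset Printing Implicit Defensive.

Import Order.TTheory GRing.Theory Num.Theory numFieldNormedType.Exports.

Local Open Scope classical_set_scope.
Local Open Scope card_scope.
Local Open Scope ring_scope.

(* Points of K^n are row vectors; a point (x, y) of K^n x K^n is a row vector of
   size n + n, with x = lsubmx and y = rsubmx. *)

Section Varieties.
Variables (K : fieldType) (n : nat).
Implicit Types (V W A : set 'rV[K]_n) (F : set (mpoly n K)) (y t u : 'rV[K]_n).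

Definition zeros F : set 'rV[K]_n :=
  [set y | forall f, F f -> meval (y 0) f = 0].

Definition vanishing A : set (mpoly n K) :=
  [set f | forall y, A y -> meval (y 0) f = 0].

Definition zariski_closure A : set 'rV[K]_n := zeros (vanishing A).

Definition algebraic V := exists F, V = zeros F.

Definition irreducible_variety V :=
  [/\ algebraic V, V !=set0 &
      forall A B, algebraic A -> algebraic B -> V `<=` A `|` B ->
        V `<=` A \/ V `<=` B].

Definition irreducible_component V W :=
  [/\ irreducible_variety W, W `<=` V &
      forall W', irreducible_variety W' -> W `<=` W' -> W' `<=` V -> W' `<=` W].

(* P_1, ..., P_s generate the vanishing ideal of V. *)
Definition ideal_generators V s (P : 'I_s -> mpoly n K) :=
  vanishing V = [set f | exists c : 'I_s -> mpoly n K, f = \sum_j c j * P j].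

Definition Dmx s (P : 'I_s -> mpoly n K) y : 'M[K]_(n, s) :=
  \matrix_(i, j) meval (y 0) (mderiv i (P j)).

(* For y in V, neither the rank nor the column space of D(V)(y) depends on the
   choice of generators, which is therefore existentially quantified. *)
Definition D_rank V y (r : nat) :=
  exists s (P : 'I_s -> mpoly n K), ideal_generators V P /\ \rank (Dmx P y) = r.

Definition D_colspace V y : set 'rV[K]_n :=
  [set u | exists s (P : 'I_s -> mpoly n K),
     ideal_generators V P /\ (u <= (Dmx P y)^T)%MS].

Definition tangent_space V y : set 'rV[K]_n :=
  [set t | exists s (P : 'I_s -> mpoly n K),
     ideal_generators V P /\ t *m Dmx P y = 0].

(* d = n - max_{y in V} rank D(V)(y) *)
Definition variety_dim V (d : nat) :=
  [/\ (d <= n)%N, exists2 y, V y & D_rank V y (n - d) &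
      forall y r, V y -> D_rank V y r -> (r <= n - d)%N].

Definition smooth_points V : set 'rV[K]_n :=
  [set y | V y /\ exists2 d, variety_dim V d & D_rank V y (n - d)].

Definition Sing V : set 'rV[K]_n := V `\` smooth_points V.

End Varieties.

Section Projection.
Variables (K : fieldType) (n : nat).
Implicit Types W : set 'rV[K]_(n + n).

Definition dominating W := zariski_closure [set lsubmx v | v in W] = setT.

(* The fibres of pi : W -> K^n over a nonempty Zariski open subset of K^n have
   exactly k points. *)
Definition proj_degree W (k : nat) :=
  exists2 f : mpoly n K, f != 0 &
    forall x : 'rV[K]_n, meval (x 0) f != 0 ->
      [set v | W v /\ lsubmx v = x] #= `I_k.

End Projection.

Section Complexification.
Variables (R : realType) (n : nat).

Definition cplx (v : 'rV[R]_n) : 'rV[R[i]]_n := map_mx (real_complex R) v.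

Definition complexification (V : set 'rV[R]_n) : set 'rV[R[i]]_n :=
  zeros [set map_mpoly (real_complex R) f | f in vanishing V].

End Complexification.

Section Correspondence.
Variables (R : realType) (n : nat).
Implicit Types C : set 'rV[R]_n.

Definition Fpow q (z : 'rV[R[i]]_n) : 'rV[R[i]]_n := map_mx (fun a => a ^+ q) z.

Definition Sigma1 (m l : nat) C : set 'rV[R[i]]_(n + n) :=
  [set v | let z := lsubmx v in let y := rsubmx v in
    (complexification C `\` Sing (complexification C)) y /\
    [set Fpow (2 * l + 1) u | u in D_colspace (complexification C) y]
      (Fpow (2 * m - 2 * l - 1) (z - y))].

(* Sigma1 is constructible, so its Zariski and Euclidean closures agree. *)
Definition Sigma (m l : nat) C : set 'rV[R[i]]_(n + n) :=
  zariski_closure (Sigma1 m l C).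

End Correspondence.

Section BestApproximation.
Variables (R : realType) (n : nat).
Implicit Types (nu g : 'rV[R]_n -> R) (C : set 'rV[R]_n).

Definition pnorm (p : R) (x : 'rV[R]_n) : R :=
  (\sum_i `|x 0 i| `^ p) `^ p^-1.

Definition dist nu x C : R := inf [set nu (x - y) | y in C].

Definition best_approx nu C x z := C z /\ dist nu x C = nu (x - z).

Definition nonunique nu C : set 'rV[R]_n :=
  [set x | exists z z', [/\ best_approx nu C x z, best_approx nu C x z' & z <> z']].

Definition Omega nu C : set 'rV[R]_(n + n) :=
  [set v | ~ nonunique nu C (lsubmx v) /\ best_approx nu C (lsubmx v) (rsubmx v)].

Definition gradient (h : 'rV[R]_n -> R) (y : 'rV[R]_n) : 'rV[R]_n :=
  \row_i 'D_(delta_mx 0 i) h y.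

Definition critical_point h C y :=
  Sing C y \/
  ((C `\` Sing C) y /\
   forall t, tangent_space C y t -> gradient h y *m t^T = 0).

Definition Sigma_g g C : set 'rV[R]_(n + n) :=
  [set v | C (rsubmx v) /\ critical_point (fun y => g (lsubmx v - y)) C (rsubmx v)]
  `\` [set v | Sing C (rsubmx v)].

End BestApproximation.

Section Stratification.
Variables (R : realType) (N : nat).
Implicit Types (V T X Y : set 'rV[R]_N).

(* Finite union of sets given by finitely many conditions f = 0 and g > 0. *)
Definition semialgebraic X :=
  exists L : seq (seq (mpoly N R) * seq (mpoly N R)),
    X = [set x | has (fun c =>
           all (fun f => meval (x 0) f == 0) c.1 &&
           all (fun g => 0 < meval (x 0) g) c.2) L].

(* X is a nonempty open semi-algebraic subset of the smooth points of the
   irreducible variety V. *)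
Definition smooth_stratum X V :=
  [/\ X !=set0, semialgebraic X, irreducible_variety V &
      exists2 O, open O & X = O `&` smooth_points V].

Definition orth_projector T (Pi : 'M[R]_N) :=
  [/\ Pi^T = Pi, Pi *m Pi = Pi & T = [set t | (t <= Pi)%MS]].

(* Convergence in the Grassmannian, as convergence of orthogonal projectors. *)
Definition subspace_cvg (T_ : nat -> set 'rV[R]_N) T :=
  exists (Pi_ : nat -> 'M[R]_N) (Pi : 'M[R]_N),
    [/\ forall k, orth_projector (T_ k) (Pi_ k), orth_projector T Pi &
        Pi_ @ \oo --> Pi].

(* Whitney's conditions (a) and (b) for the pair of strata (X, Y); V and V' are
   the varieties of X and Y, whence the tangent spaces of the strata. *)
Definition whitney_a X V Y V' :=
  forall (x_ : nat -> 'rV[R]_N) y T,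
    (forall k, X (x_ k)) -> Y y -> x_ @ \oo --> y ->
    subspace_cvg (fun k => tangent_space V (x_ k)) T ->
    tangent_space V' y `<=` T.

Definition whitney_b X V Y :=
  forall (x_ y_ : nat -> 'rV[R]_N) y T L,
    (forall k, X (x_ k)) -> (forall k, Y (y_ k)) -> (forall k, x_ k <> y_ k) ->
    Y y -> x_ @ \oo --> y -> y_ @ \oo --> y ->
    subspace_cvg (fun k => tangent_space V (x_ k)) T ->
    subspace_cvg (fun k => [set t | (t <= x_ k - y_ k)%MS]) L ->
    L `<=` T.

Definition whitney_stratification (A : set 'rV[R]_N) (s : nat)
    (Theta V : nat -> set 'rV[R]_N) :=
  [/\ A = \bigcup_(i < s) Theta i,
      trivIset `I_s Theta,
      forall i, (i < s)%N -> smooth_stratum (Theta i) (V i) &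
      forall i j, (i < s)%N -> (j < s)%N -> i <> j ->
        whitney_a (Theta i) (V i) (Theta j) (V j) /\
        whitney_b (Theta i) (V i) (Theta j)].

End Stratification.

(* delta is the nu-distance degree of C computed from some stratification
   Theta_0, ..., Theta_{s-1}, where Theta_i has dimension n exactly for i < M and
   V_0, ..., V_{k-1} are the distinct varieties among V_0, ..., V_{M-1}. *)
Definition distance_degree (R : realType) (n : nat) (nu : 'rV[R]_n -> R)
    (C : set 'rV[R]_n) (delta : nat) :=
  exists (s M k : nat) (Theta V : nat -> set 'rV[R]_(n + n)) (deg : nat -> nat),
    [/\ whitney_stratification (Omega nu C `\` [set v | Sing C (rsubmx v)])
          s Theta V,
        [/\ (k <= M <= s)%N,
            forall i, (i < M)%N -> variety_dim (V i) n &
            forall i, (M <= i < s)%N -> exists2 e, (e < n)%N & variety_dim (V i) e],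
        (forall i j, (i < k)%N -> (j < k)%N -> V i = V j -> i = j) /\
        (forall i, (i < M)%N -> exists2 j, (j < k)%N & V i = V j),
        forall i, (i < k)%N -> proj_degree (complexification (V i)) (deg i) &
        delta = (\sum_(i < k) deg i)%N].

(* Main.v *)
Require Import Defs.
From mathcomp Require Import all_boot all_order all_algebra.
From mathcomp Require Import boolp classical_sets functions cardinality reals.
From mathcomp Require Import interval_inference.
From mathcomp Require Import topology normedtype derive realfun exp.
From mathcomp Require Import complex.
From mathcomp Require Import -(notations) mpoly.
From mathcomp Require Import ring lra zify.

(** Why the theorem holds.

  Let [y] be a best approximation of [x] in [C] that is a smooth point of [C]. By
  the multiplier rule the gradient of sum |x_i - y_i|^p at [y] is normal to [C].
  Up to a factor its entries are the signed powers of x_i - y_i of exponent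
  p - 1 = (2m - 2l - 1) / (2l + 1), and the powers 2l + 1 of these are
  (x_i - y_i)^(2m - 2l - 1). Real generators of the ideal of [C] also generate the
  ideal of its complexification, so (x, y) is a real point of [Sigma], hence of
  [S1]: this is [minimizer_in_Sigma]. Close to a smooth point of [C] every [x] has
  a best approximation which is smooth ([near_smooth_minimizer]); the projection
  of [S1] contains therefore a real open set and is dominating
  ([dominating_of_real_points]).

  For the degree, take a stratification of [Omega] away from the singular points.
  The points of all strata lie in [S1] by the first part. If the variety [V] of a
  stratum has dimension n, the stratum is Zariski dense in the complexification
  of [V], which is thus contained in [S1] and equal to it for reasons of dimension
  ([complexification_eq_component]). So all the varieties of dimension n coincide
  and the sum that defines the distance degree has at most one term, which is the
  degree of [S1]. It has one: varieties of smaller dimension lie over proper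
  hypersurfaces of the space of the [x], whereas strict convexity of the norm
  shows that moving [x] slightly towards a best approximation [y] makes [y] the
  only one ([unique_minimizer]), so that [Omega] does not lie over a hypersurface
  ([exists_top_stratum]).

  Two tools carry this. The dimension is defined by ranks of Jacobian matrices; it
  is compared with algebraic dependence of the coordinates by pseudo-division
  ([grad_span_ndep]), which bounds the size of independent sets of coordinates
  ([independent_le_dim]) and shows that a proper subvariety has smaller dimension
  ([ideal_eq_of_dim]). On the analytic side, Cramer's rule extends each tangent
  vector at a smooth point to a polynomial vector field that preserves the ideal
  of the variety ([tangent_field]). Combined with a quadratic penalty, these fields
  give the multiplier rule ([lagrange_multipliers]) without any parametrization of
  the variety; applied to polynomials that vanish near a smooth point, the rule
  yields in turn the Zariski density of the real smooth points
  ([vanishing_open_smooth]). *)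

Set Implicit Arguments.
Unset Strict Implicit.
Unset Printing Implicit Defensive.

Import Order.TTheory GRing.Theory Num.Theory numFieldNormedType.Exports.

Local Open Scope classical_set_scope.
Local Open Scope ring_scope.

Local Notation var K j := (mpolyX K (mnm1 j)).
Local Notation ev y f := (meval (y 0) f).

(** * Adjoining an element to a subring *)

Section Adjunction.
Variable A : idomainType.
Implicit Types (S I J : set A) (P Q R : {poly A}) (x : A).

Definition is_subring S :=
  [/\ S 1, forall f g, S f -> S g -> S (f - g)
    & forall f g, S f -> S g -> S (f * g)].

Definition is_ideal I :=
  [/\ I 0, forall f g, I f -> I g -> I (f + g) & forall f g, I g -> I (f * g)].

Definition is_prime I := ~ I 1 /\ forall f g, I (f * g) -> I f \/ I g.

Definition coefs_in S : set {poly A} := [set P | forall k, S P`_k].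

Definition adjoin S x : set A := [set P.[x] | P in coefs_in S].

Section Subring.
Variable S : set A.
Hypothesis subS : is_subring S.

Lemma subring0 : S 0.
Proof. by case: subS => S1 SB _; rewrite -(subrr 1); apply: SB. Qed.

Lemma subringN f : S f -> S (- f).
Proof. by case: subS => _ SB _ Sf; rewrite -sub0r; apply: SB => //; apply: subring0. Qed.

Lemma subringD f g : S f -> S g -> S (f + g).
Proof. by case: subS => _ SB _ Sf Sg; rewrite -[g]opprK; apply: SB => //; apply: subringN. Qed.

Lemma subringM f g : S f -> S g -> S (f * g).
Proof. by case: subS => _ _; apply. Qed.

Lemma subring1 : S 1. Proof. by case: subS. Qed.

Lemma subring_exp f k : S f -> S (f ^+ k).
Proof.
move=> Sf; elim: k => [|k IH]; first by rewrite expr0; apply: subring1.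
by rewrite exprS; apply: subringM.
Qed.

Lemma subring_nat k : S k%:R.
Proof.
elim: k => [|k IH]; first exact: subring0.
by rewrite -natr1; apply: subringD => //; apply: subring1.
Qed.

Lemma coefs_inC f : S f -> coefs_in S f%:P.
Proof. by move=> h k; rewrite coefC; case: ifP => _ //; apply: subring0. Qed.

Lemma coefs_inD P Q : coefs_in S P -> coefs_in S Q -> coefs_in S (P + Q).
Proof. by move=> h h' k; rewrite coefD; apply: subringD. Qed.

Lemma coefs_inB P Q : coefs_in S P -> coefs_in S Q -> coefs_in S (P - Q).
Proof. by move=> h h' k; rewrite coefB; case: subS => _ SB _; apply: SB. Qed.

Lemma coefs_inM P Q : coefs_in S P -> coefs_in S Q -> coefs_in S (P * Q).
Proof.
move=> h h' k; rewrite coefM; elim/big_ind: _ => [||i _].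
- exact: subring0.
- exact: subringD.
- exact: subringM.
Qed.

Lemma coefs_inXn k : coefs_in S 'X^k.
Proof. by move=> i; rewrite coefXn; apply: subring_nat. Qed.

Lemma coefs_inZ f P : S f -> coefs_in S P -> coefs_in S (f *: P).
Proof. by move=> h h' k; rewrite coefZ; apply: subringM. Qed.

Lemma subring_adjoin x : is_subring (adjoin S x).
Proof.
split.
- by exists 1; [rewrite -(expr0 'X); apply: coefs_inXn|rewrite hornerC].
- by move=> _ _ [P hP <-] [Q hQ <-]; exists (P - Q); [apply: coefs_inB|rewrite hornerE hornerN].
- by move=> _ _ [P hP <-] [Q hQ <-]; exists (P * Q); [apply: coefs_inM|rewrite hornerM].
Qed.

Lemma sub_adjoin x : S `<=` adjoin S x.
Proof. by move=> f Sf; exists f%:P; [apply: coefs_inC|rewrite hornerC]. Qed.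

Lemma adjoin_gen x : adjoin S x x.
Proof. by exists 'X; [apply: (@coefs_inXn 1)|rewrite hornerX]. Qed.

(** Euclidean division without inverting the leading coefficient, arranged so that
  quotient and remainder keep their coefficients in [S]. *)
Lemma pseudo_division P Q : coefs_in S P -> coefs_in S Q -> Q != 0 ->
  exists k B R, [/\ coefs_in S B, coefs_in S R, (size R < size Q)%N &
    lead_coef Q ^+ k *: P = B * Q + R].
Proof.
move=> + hQ Q0; have [m] := ubnP (size P); elim: m P => // m IH P Pm hP.
have [PQ|QP] := ltnP (size P) (size Q).
  exists 0%N, 0, P; split => //; last by rewrite expr0 scale1r mul0r add0r.
  by move=> k; rewrite coef0; apply: subring0.
have sQ : (0 < size Q)%N by rewrite size_poly_gt0.
have sP : (0 < size P)%N by rewrite (leq_trans _ QP).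
pose e := (size P - size Q)%N.
pose P' := lead_coef Q *: P - (lead_coef P *: 'X^e) * Q.
have hB : coefs_in S (lead_coef P *: 'X^e).
  by apply: coefs_inZ; [apply: hP|apply: coefs_inXn].
have hP' : coefs_in S P'.
  by apply: coefs_inB; [apply: coefs_inZ => //; apply: hQ|apply: coefs_inM].
have sP' : (size P' < size P)%N.
  rewrite -(prednK sP) ltnS; apply/leq_sizeP => k hk.
  rewrite coefB coefZ -scalerAl coefZ ['X^e * _]mulrC coefMXn.
  have /negbTE -> : ~~ (k < e)%N by rewrite -leqNgt; apply: leq_trans hk; rewrite /e -subn1 leq_sub2l.
  move: hk; rewrite leq_eqVlt => /orP [/eqP <-|hk].
    have -> : ((size P).-1 - e)%N = (size Q).-1.
      by rewrite /e -!subn1 subnAC subKn.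
    by rewrite -!lead_coefE mulrC subrr.
  rewrite !nth_default ?mulr0 ?subr0//; last by rewrite -(prednK sP).
  apply: (@leq_trans (size P - e)%N); first by rewrite /e subKn.
  by rewrite leq_sub2r// -(prednK sP).
have [k [B [R [h1 h2 h3 h4]]]] := IH P' (leq_trans sP' Pm) hP'.
exists k.+1, (B + lead_coef Q ^+ k *: (lead_coef P *: 'X^e)), R; split => //.
  by apply: coefs_inD => //; apply: coefs_inZ => //; apply: subring_exp; apply: hQ.
rewrite mulrDl -addrA [_ + R]addrC addrA -h4 exprSr -scalerA /P' scalerBr.
by rewrite -(scalerAl (lead_coef Q ^+ k)) subrK.
Qed.

End Subring.

Lemma derivation_horner (D : A -> A) (D0 : D 0 = 0)
    (DD : forall f g, D (f + g) = D f + D g)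
    (DM : forall f g, D (f * g) = D f * g + f * D g) P x :
  (forall k, D P`_k = 0) -> D P.[x] = P^`().[x] * D x.
Proof.
elim/poly_ind: P => [|P c IH] hP; first by rewrite deriv0 !horner0 D0 mul0r.
have Dc : D c = 0 by have := hP 0%N; rewrite coefD coefMX coefC /= add0r.
have {}hP k : D P`_k = 0 by have := hP k.+1; rewrite coefD coefMX coefC /= addr0.
rewrite derivMXaddC !hornerE DD DM Dc IH //; ring.
Qed.

(** Differentiating a polynomial relation of [x] over [S] yields one of smaller
  degree; in characteristic 0 only the trivial relation survives this descent. *)
Lemma derivation_transcendental S (D : A -> A) (D0 : D 0 = 0)
    (DD : forall f g, D (f + g) = D f + D g)
    (DM : forall f g, D (f * g) = D f * g + f * D g) P x :
  is_subring S -> [pchar A] =i pred0 -> (forall f, S f -> D f = 0) -> D x = 1 ->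
  coefs_in S P -> P.[x] = 0 -> P = 0.
Proof.
move=> subS chA DS Dx.
have [m] := ubnP (size P); elim: m P => // m IH P Pm hP Px.
have dPx : P^`().[x] = 0.
  have := derivation_horner D0 DD DM x (fun k => DS _ (hP k)).
  by rewrite Px D0 Dx mulr1.
have dP : P^`() = 0.
  have [->|nz] := eqVneq P 0; first by rewrite deriv0.
  apply: IH => //; first by rewrite (leq_trans _ (_ : size P <= m)%N)// lt_size_deriv.
  move=> k; rewrite coef_deriv -mulr_natl; apply: subringM => //.
  exact: subring_nat.
have PC : P = (P`_0)%:P.
  apply/polyP => -[|k]; rewrite coefC //=.
  have /(congr1 (fun p : {poly A} => p`_k)) := dP; rewrite coef_deriv coef0.
  rewrite -mulr_natl => /eqP; rewrite mulf_eq0 => /orP [|/eqP//].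
  by rewrite (proj1 (pcharf0P _) chA).
by move: Px; rewrite PC hornerC => ->.
Qed.

Section Dependence.
Variables (S I : set A) (x : A).
Hypotheses (subS : is_subring S) (idI : is_ideal I) (prI : is_prime I).

Lemma idealN f : I f -> I (- f).
Proof. by case: idI => _ _ IM h; rewrite -mulN1r; apply: IM. Qed.

Lemma idealB f g : I f -> I g -> I (f - g).
Proof. by case: idI => _ ID _ h h'; apply: ID => //; apply: idealN. Qed.

Lemma prime_exp f k : ~ I f -> ~ I (f ^+ k).
Proof.
move=> h; elim: k => [|k IH]; first by rewrite expr0; case: prI.
by rewrite exprS => /(proj2 prI) [].
Qed.

(** Algebraic dependence of [x] on [S] in the ring modulo [I]. The leading
  coefficient must survive modulo [I], or every [x] would be dependent as soon as
  [I] meets [S]. *)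
Definition dependent :=
  exists P, [/\ coefs_in S P, (1 < size P)%N, ~ I (lead_coef P) & I P.[x]].

(** A leading term with coefficient in [I] can be dropped from a relation modulo
  [I]; when no relation of degree at most [b] has another leading coefficient,
  dropping the terms one after the other exhausts the relation. *)
Lemma ideal_coefs (b : nat) :
  (forall P, coefs_in S P -> (1 < size P <= b)%N -> I P.[x] -> I (lead_coef P)) ->
  forall P, coefs_in S P -> (size P <= b)%N -> I P.[x] -> forall k, I P`_k.
Proof.
move=> h P; have [m] := ubnP (size P); elim: m P => // m IH P Pm hP Pb Px.
have [->|P0] := eqVneq P 0; first by move=> k; rewrite coef0; case: idI.
have lP : I (lead_coef P).
  have [P1|P1] := ltnP 1 (size P); first by apply: h => //; rewrite P1.
  by move: Px; rewrite (size1_polyC P1) lead_coefC hornerC.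
have sP : (0 < size P)%N by rewrite size_poly_gt0.
pose R := P - lead_coef P *: 'X^((size P).-1).
have RS : coefs_in S R.
  by apply: coefs_inB => //; apply: coefs_inZ => //; [apply: hP|apply: coefs_inXn].
have sR : (size R < size P)%N.
  rewrite -(prednK sP) ltnS; apply/leq_sizeP => k hk.
  rewrite coefB coefZ coefXn; case: eqP => [->|/eqP kP].
    by rewrite mulr1 -lead_coefE subrr.
  by rewrite mulr0 subr0 nth_default// -(prednK sP) ltn_neqAle eq_sym kP.
have Rx : I R.[x].
  rewrite /R hornerD hornerN hornerZ; apply: idealB => //.
  by case: idI => _ _ IM; rewrite mulrC; apply: IM.
have IR := IH R (leq_trans sR Pm) RS (ltnW (leq_trans sR Pb)) Rx.
move=> k; have -> : P`_k = R`_k + lead_coef P * ('X^((size P).-1) : {poly A})`_k.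
    by rewrite /R coefB coefZ subrK.
case: idI => _ ID IM; apply: ID; first exact: IR.
by rewrite mulrC; apply: IM.
Qed.

Lemma independent_coefs P : ~ dependent -> coefs_in S P -> I P.[x] ->
  forall k, I P`_k.
Proof.
move=> nd hP Px; apply: (@ideal_coefs (size P)) => // Q hQ /andP [Q1 _] Qx.
by apply: contrapT => lQ; apply: nd; exists Q.
Qed.

Lemma minimal_relation : dependent ->
  exists Q, [/\ coefs_in S Q, (1 < size Q)%N, ~ I (lead_coef Q), I Q.[x] &
    forall P, coefs_in S P -> (size P < size Q)%N -> I P.[x] -> forall k, I P`_k].
Proof.
case=> P0 [h1 h2 h3 h4].
pose rel b := `[< exists P, [/\ coefs_in S P, (1 < size P)%N, ~ I (lead_coef P), I P.[x]
   & size P = b] >].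
have exb : exists b, rel b by exists (size P0); apply/asboolP; exists P0.
case: (ex_minnP exb) => b /asboolP [Q [q1 q2 q3 q4 <-]] bmin.
exists Q; split => // P hP PQ Px.
apply: (@ideal_coefs (size Q).-1) => //; last by rewrite -ltnS prednK// ltnW.
move=> P1 hP1 /andP [P11 P1b] P1x; apply: contrapT => lP1.
have /bmin : rel (size P1) by apply/asboolP; exists P1.
by rewrite leqNgt -(prednK (ltnW q2)) ltnS P1b.
Qed.

(** An algebraic relation [Q(x)] of minimal degree is irreducible over the field
  of fractions of [S / I]; an element of [S[x]] outside of [I] is therefore
  coprime to it, and together they generate an element of [S] outside of [I].
  The minimal degree in [x] of an element of [J] outside of [I] plays the part of
  the greatest common divisor. *)
Lemma ideal_contraction J : dependent -> is_ideal J -> I `<=` J ->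
  (exists2 f, adjoin S x f & J f /\ ~ I f) ->
  exists2 f, S f & J f /\ ~ I f.
Proof.
move=> /minimal_relation [Q [Q1 Q2 Q3 Q4 Q5]] idJ IJ [_ [P0 hP0 <-] [JP0 IP0]].
pose rel b := `[< exists P, [/\ coefs_in S P, J P.[x], ~ I P.[x] & size P = b] >].
have exb : exists b, rel b by exists (size P0); apply/asboolP; exists P0.
case: (ex_minnP exb) => b /asboolP [G [g1 g2 g3 <-]] bmin.
have [G1|G1] := leqP (size G) 1.
  exists G`_0; first exact: g1.
  by move: g2 g3; rewrite (size1_polyC G1) hornerC coefC eqxx.
have G0 : G != 0 by rewrite -size_poly_gt0 ltnW.
have small P : coefs_in S P -> (size P < size G)%N -> J P.[x] -> I P.[x].
  move=> hP sP JP; apply: contrapT => nI.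
  have /bmin : rel (size P) by apply/asboolP; exists P.
  by rewrite leqNgt sP.
have lG : ~ I (lead_coef G).
  move=> lG; apply: g3.
  pose R := G - lead_coef G *: 'X^((size G).-1).
  have RS : coefs_in S R.
    by apply: coefs_inB => //; apply: coefs_inZ => //; [apply: g1|apply: coefs_inXn].
  have IX : I (lead_coef G *: 'X^((size G).-1)).[x].
    by rewrite hornerZ mulrC; case: idI => _ _; apply.
  have sR : (size R < size G)%N.
    rewrite -(prednK (ltnW G1)) ltnS; apply/leq_sizeP => k hk.
    rewrite coefB coefZ coefXn; case: eqP => [->|/eqP kP].
      by rewrite mulr1 -lead_coefE subrr.
    by rewrite mulr0 subr0 nth_default// -(prednK (ltnW G1)) ltn_neqAle eq_sym kP.
  have -> : G = R + lead_coef G *: 'X^((size G).-1) by rewrite subrK.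
  rewrite hornerD; case: (idI) => _ ID _; apply: ID => //; apply: small => //.
  rewrite /R hornerD hornerN; case: idJ => _ JD JM; apply: JD => //.
  by rewrite -mulN1r; apply: JM; apply: IJ.
have [k [B [R [hB hR sR eqn]]]] := pseudo_division subS Q1 g1 G0.
have eqx := congr1 (fun P => P.[x]) eqn.
rewrite /= hornerZ hornerD hornerM in eqx.
have IR : I R.[x].
  apply: small => //; have -> : R.[x] = lead_coef G ^+ k * Q.[x] - B.[x] * G.[x].
    by rewrite eqx addrC addKr.
  case: idJ => _ JD JM; apply: JD; first by apply: JM; apply: IJ.
  by rewrite -mulNr; apply: JM.
have IBG : I (B.[x] * G.[x]).
  have -> : B.[x] * G.[x] = lead_coef G ^+ k * Q.[x] - R.[x] by rewrite eqx addrK.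
  by apply: idealB => //; case: idI => _ _; apply.
have IB : I B.[x] by case: (proj2 prI _ _ IBG).
(* otherwise the remainder of G modulo Q would contradict the minimality of G *)
have GQ : (size G <= size Q)%N.
  rewrite leqNgt; apply/negP => QG.
  have Qn0 : Q != 0 by rewrite -size_poly_gt0 ltnW.
  have [k' [B' [R' [hB' hR' sR' eqn']]]] := pseudo_division subS g1 Q1 Qn0.
  have := congr1 (fun P => P.[x]) eqn'; rewrite /= hornerZ hornerD hornerM => eqx'.
  have IR' : I R'.[x].
    apply: small => //; first exact: ltn_trans QG.
    have -> : R'.[x] = lead_coef Q ^+ k' * G.[x] - B'.[x] * Q.[x].
      by rewrite eqx' addrC addKr.
    case: idJ => _ JD JM; apply: JD; first exact: JM.
    by rewrite -mulNr; apply: JM; apply: IJ.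
  have : I (lead_coef Q ^+ k' * G.[x]).
    by rewrite eqx'; case: (idI) => _ ID IM; apply: ID => //; apply: IM.
  by case/(proj2 prI) => //; apply: prime_exp.
have szR : (size R < size (lead_coef G ^+ k *: Q))%N.
  by rewrite size_scale ?expf_neq0 ?lead_coef_eq0//; apply: leq_trans GQ.
have B0 : B != 0.
  apply/eqP => B0; move: szR; rewrite eqn B0 mul0r add0r ltnn //.
(* the quotient B has smaller degree than the minimal relation Q *)
have [] : ~ I (lead_coef B * lead_coef G).
  rewrite -lead_coefM -(addrK R (B * G)) -eqn lead_coefDl ?size_polyN//.
  by rewrite lead_coefZ => /(proj2 prI) [/prime_exp|].
rewrite mulrC; case: (idI) => _ _ IM; apply: IM; rewrite lead_coefE; apply: Q5 => //.
have := congr1 (fun P : {poly A} => size P) eqn.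
rewrite size_scale ?expf_neq0 ?lead_coef_eq0//.
have sB : (0 < size B)%N by rewrite size_poly_gt0.
have sBG : (size R < size (B * G)%R)%N.
  by rewrite size_mul// (leq_trans sR)// -(prednK sB) addSn leq_addl.
rewrite size_polyDl// size_mul// => ->; rewrite -(prednK (ltnW G1)) addnS /=.
by rewrite -[X in (X < _)%N]addn0 ltn_add2l -ltnS prednK// ltnW.
Qed.

End Dependence.

End Adjunction.

(** * Polynomials in some of the variables *)

Section PolysIn.
Variables (K : numFieldType) (N : nat).
Local Notation A := (mpoly N K).
Implicit Types (s : seq 'I_N) (f g : A) (j : 'I_N).

(** The subring K[x_j : j in s], built by adjoining the variables from the last
  entry of [s] to the first, so that each variable can be compared with the
  variables after it. *)
Definition polys_in s : set A :=
  foldr (fun j S => adjoin S (var K j)) [set mpolyC N c | c in setT] s.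

Lemma subring_polys_in s : is_subring (polys_in s).
Proof.
elim: s => [|j s IH] /=; last exact: subring_adjoin.
split.
- by exists 1 => //; rewrite mpolyC1.
- by move=> _ _ [a _ <-] [b _ <-]; exists (a - b) => //; rewrite mpolyCB.
- by move=> _ _ [a _ <-] [b _ <-]; exists (a * b) => //; rewrite mpolyCM.
Qed.

Lemma polys_in_C s c : polys_in s (mpolyC N c).
Proof.
elim: s => [|j s IH]; first by exists c.
exact: (sub_adjoin (subring_polys_in s)).
Qed.

Lemma polys_in_cons s j f : polys_in s f -> polys_in (j :: s) f.
Proof. by move=> h; apply: (sub_adjoin (subring_polys_in s)). Qed.

Lemma polys_in_var s j : j \in s -> polys_in s (var K j).
Proof.
elim: s => // i s IH; rewrite inE => /orP [/eqP ->|/IH]; last exact: polys_in_cons.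
exact: (adjoin_gen (subring_polys_in s)).
Qed.

Lemma polys_in_full s f : (forall j, j \in s) -> polys_in s f.
Proof.
have subS := subring_polys_in s.
move=> h; elim/mpolyind: f => [|c m f _ _ IH]; first exact: subring0 subS.
apply: (subringD subS) => //; rewrite -mul_mpolyC.
apply: (subringM subS); first exact: polys_in_C.
rewrite mpolyXE_id; elim/big_ind: _ => [||i _].
- exact: subring1 subS.
- exact: subringM subS.
exact/(subring_exp subS)/polys_in_var.
Qed.

Lemma mderiv_var i j : mderiv i (var K j) = (i == j)%:R.
Proof.
rewrite mderivX mnmE eq_sym; case: eqVneq => [->|_]; last by rewrite scale0r.
by rewrite scale1r -mpolyX0; congr mpolyX; apply/mnmP => k; rewrite !mnmE subnn.
Qed.

Lemma polys_in_mderiv s f i : i \notin s -> polys_in s f -> mderiv i f = 0.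
Proof.
elim: s f => [|j s IH] f; first by move=> _ [c _ <-]; rewrite mderivC.
rewrite inE negb_or => /andP [ij si] [P hP <-].
rewrite (derivation_horner (mderiv0 _ i) (mderivD i) (mderivM i)).
  by rewrite mderiv_var (negbTE ij) mulr0.
by move=> k; apply: IH => //; apply: hP.
Qed.

Lemma meval_sum (v : 'I_N -> K) (I : Type) (r : seq I) (P : pred I) (F : I -> A) :
  meval v (\sum_(i <- r | P i) F i) = \sum_(i <- r | P i) meval v (F i).
Proof. exact: (big_morph (meval v) (mevalD v) (meval0 v)). Qed.

Lemma meval_exp (v : 'I_N -> K) f k : meval v (f ^+ k) = meval v f ^+ k.
Proof.
by elim: k => [|k IH]; rewrite ?expr0 ?meval1// !exprS mevalM IH.
Qed.

Lemma polys_in_eval s f (y z : 'rV[K]_N) :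
  polys_in s f -> {in s, forall i, y 0 i = z 0 i} -> ev y f = ev z f.
Proof.
elim: s f => [|j s IH] f; first by move=> [c _ <-] _; rewrite !mevalC.
move=> [P hP <-] h.
rewrite !horner_coef !meval_sum; apply: eq_bigr => k _.
rewrite !mevalM !meval_exp !mevalXU (h j) ?mem_head//; congr (_ * _).
apply: IH => [|i si]; first exact: hP.
by apply: h; rewrite inE si orbT.
Qed.

Lemma pchar_mpoly : [pchar A] =i pred0.
Proof.
move=> p; apply/negbTE/negP => /andP [/prime_gt0 p0].
by rewrite -mpolyC_nat mpolyC_eq0 pnatr_eq0 -leqn0 leqNgt p0.
Qed.

Lemma polys_in_transcendental s j (P : {poly A}) :
  j \notin s -> coefs_in (polys_in s) P -> P.[var K j] = 0 -> P = 0.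
Proof.
move=> js.
apply: (derivation_transcendental (mderiv0 _ j) (mderivD j) (mderivM j)
  (subring_polys_in s) pchar_mpoly) => [f|].
  exact: polys_in_mderiv.
by rewrite mderiv_var eqxx.
Qed.

End PolysIn.

(** * Gradients and the vanishing ideal *)

Section Gradients.
Variables (K : numFieldType) (N : nat).
Local Notation A := (mpoly N K).
Implicit Types (f g : A) (y : 'rV[K]_N) (V : set 'rV[K]_N).

Definition grad y f : 'rV[K]_N := \row_i ev y (mderiv i f).

Lemma gradD y f g : grad y (f + g) = grad y f + grad y g.
Proof. by apply/rowP => i; rewrite !mxE mderivD mevalD. Qed.

Lemma gradM y f g : grad y (f * g) = ev y g *: grad y f + ev y f *: grad y g.
Proof. by apply/rowP => i; rewrite !mxE mderivM mevalD !mevalM mulrC. Qed.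

Lemma grad0 y : grad y 0 = 0.
Proof. by apply/rowP => i; rewrite !mxE mderiv0 meval0. Qed.

Lemma grad_sum y (I : Type) (r : seq I) (P : pred I) (F : I -> A) :
  grad y (\sum_(i <- r | P i) F i) = \sum_(i <- r | P i) grad y (F i).
Proof. exact: (big_morph (grad y) (gradD y) (grad0 y)). Qed.

Lemma ideal_vanishing V : is_ideal (vanishing V).
Proof.
split.
- by move=> y _; rewrite meval0.
- by move=> f g hf hg y Vy; rewrite mevalD hf// hg// addr0.
- by move=> f g hg y Vy; rewrite mevalM hg// mulr0.
Qed.

Lemma prime_vanishing V : irreducible_variety V -> is_prime (vanishing V).
Proof.
move=> [_ [y Vy] irr]; split => [/(_ y Vy)|f g fg].
  by rewrite meval1 => /eqP; rewrite oner_eq0.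
have algf h : algebraic (zeros [set h : A]) by exists [set h].
have [|h|h] := irr _ _ (algf f) (algf g).
- move=> z Vz; have /eqP := fg z Vz; rewrite mevalM mulf_eq0 => /orP [] /eqP h.
  + by left => _ ->.
  + by right => _ ->.
- by left => z /h /(_ f); apply.
- by right => z /h /(_ g); apply.
Qed.

Lemma not_vanishing V f : ~ vanishing V f -> exists2 y, V y & ev y f != 0.
Proof.
move=> h; apply: contrapT => h'; apply: h => y Vy; apply: contrapT => /eqP fy.
by apply: h'; exists y.
Qed.

(** The row space of this matrix is the span of the gradients at [y]. *)
Definition grad_span (qs : seq A) y : 'M[K]_N := (\sum_(q <- qs) <<grad y q>>)%MS.

Lemma grad_span_cons q qs y :
  (grad_span (q :: qs) y :=: grad y q + grad_span qs y)%MS.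
Proof. by rewrite /grad_span big_cons; apply/eqmxP; rewrite !(addsmxS, genmxE) /=. Qed.

Lemma rank_grad_span qs y : (\rank (grad_span qs y) <= size qs)%N.
Proof.
elim: qs => [|q qs IH]; first by rewrite /grad_span big_nil mxrank0.
rewrite grad_span_cons; apply: leq_trans (mxrank_adds_leqif _ _) _.
exact: leq_add (rank_leq_row _) IH.
Qed.

End Gradients.

(** * Dimension and algebraic dependence *)

Section Dimension.
Variables (K : numFieldType) (N : nat).
Local Notation A := (mpoly N K).
Implicit Types (f g : A) (y : 'rV[K]_N) (V : set 'rV[K]_N) (s : seq 'I_N).

Lemma generator_vanishing V k (P : 'I_k -> A) j :
  ideal_generators V P -> vanishing V (P j).
Proof.
move=> ->; exists (fun i => (i == j)%:R).
rewrite (bigD1 j) //= eqxx mul1r big1 ?addr0// => i /negbTE ->.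
by rewrite mul0r.
Qed.

Lemma row_Dmx k (P : 'I_k -> A) y j : row j (Dmx P y)^T = grad y (P j).
Proof. by apply/rowP => i; rewrite !mxE. Qed.

(** At a point of [V] the products in f = sum c_j P_j differentiate to c_j dP_j
  alone, because P_j vanishes there. *)
Lemma grad_sub_Dmx V k (P : 'I_k -> A) y f :
  ideal_generators V P -> V y -> vanishing V f ->
  (grad y f <= (Dmx P y)^T)%MS.
Proof.
move=> gP Vy; rewrite gP => -[c ->]; rewrite grad_sum; apply: summx_sub => j _.
rewrite gradM (generator_vanishing j gP)// scale0r add0r -row_Dmx.
by rewrite scalemx_sub// row_sub.
Qed.

Lemma Dmx_sub V k (P : 'I_k -> A) k' (P' : 'I_k' -> A) y :
  ideal_generators V P -> ideal_generators V P' -> V y ->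
  ((Dmx P y)^T <= (Dmx P' y)^T)%MS.
Proof.
move=> gP gP' Vy; apply/row_subP => j; rewrite row_Dmx.
exact/(grad_sub_Dmx gP' Vy)/(generator_vanishing j gP).
Qed.

Lemma D_rankP V k (P : 'I_k -> A) y r :
  ideal_generators V P -> V y -> D_rank V y r -> \rank (Dmx P y) = r.
Proof.
move=> gP Vy [k' [P' [gP' <-]]]; rewrite -mxrank_tr -[in RHS]mxrank_tr.
apply/eqP; rewrite eqn_leq (mxrankS (Dmx_sub gP gP' Vy)).
exact: mxrankS (Dmx_sub gP' gP Vy).
Qed.

Lemma left_right_factors m n r (D : 'M[K]_(m, n)) : (r <= \rank D)%N ->
  exists (L : 'M_(r, m)) (Rt : 'M_(n, r)), L *m D *m Rt = 1%:M.
Proof.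
move=> rD; exists (pid_mx r *m invmx (col_ebase D)), (invmx (row_ebase D) *m pid_mx r).
rewrite -[in X in _ *m X *m _](mulmx_ebase D) !mulmxA mulmxKV ?col_ebase_unit//.
rewrite -!mulmxA mulKVmx ?row_ebase_unit// mulmxA.
rewrite !mul_pid_mx.
rewrite (minn_idPl rD) (minn_idPr (leq_trans rD (rank_leq_row D))) minnn.
rewrite (minn_idPr (leq_trans rD (rank_leq_col D))).
by rewrite pid_mx_1.
Qed.

(** With constant matrices [L] and [Rt] in place of a choice of rows and columns,
  the condition that D(V) has rank at least [r] becomes the nonvanishing of one
  polynomial: a matrix of rank at least [r] has L D R = 1 for suitable L and R. *)
Definition minor_poly k (P : 'I_k -> A) r (L : 'M[K]_(r, N)) (Rt : 'M[K]_(k, r)) : A :=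
  \det (map_mx (@mpolyC N K) L *m (\matrix_(i, j) mderiv i (P j)) *m map_mx (@mpolyC N K) Rt).

Lemma ev_minor_poly k (P : 'I_k -> A) r (L : 'M[K]_(r, N)) (Rt : 'M[K]_(k, r)) y :
  ev y (minor_poly P L Rt) = \det (L *m Dmx P y *m Rt).
Proof.
have -> : ev y (minor_poly P L Rt) = \det (map_mx (meval (y 0))
   (map_mx (@mpolyC N K) L *m (\matrix_(i, j) mderiv i (P j)) *m map_mx (@mpolyC N K) Rt)).
  by rewrite det_map_mx.
rewrite !map_mxM; congr (\det (_ *m _ *m _)).
- by apply/matrixP => i j; rewrite !mxE; exact: mevalC.
- by apply/matrixP => i j; rewrite !mxE.
- by apply/matrixP => i j; rewrite !mxE; exact: mevalC.
Qed.

Lemma det_neq0_rank m n r (L : 'M[K]_(r, m)) (D : 'M[K]_(m, n)) (Rt : 'M[K]_(n, r)) :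
  \det (L *m D *m Rt) != 0 -> (r <= \rank D)%N.
Proof.
rewrite -unitfE => u; have /mxrank_unit rLDR : L *m D *m Rt \in unitmx by [].
rewrite -[X in (X <= _)%N]rLDR.
exact: leq_trans (mxrankM_maxl _ _) (mxrankM_maxr _ _).
Qed.

Lemma exists_minor k (P : 'I_k -> A) y r : (r <= \rank (Dmx P y))%N ->
  exists (L : 'M[K]_(r, N)) (Rt : 'M[K]_(k, r)), ev y (minor_poly P L Rt) != 0.
Proof.
move=> /left_right_factors [L [Rt LR]]; exists L, Rt.
by rewrite ev_minor_poly LR det1 oner_eq0.
Qed.

Fixpoint ndep (I : set A) s : nat :=
  if s is j :: s' then (`[< dependent (@polys_in K N s') I (var K j) >] + ndep I s')%N
  else 0%N.

Lemma ndep_cat I t s : (ndep I (t ++ s) <= size t + ndep I s)%N.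
Proof.
elim: t => //= j t IH; apply: leq_trans (leq_add (leq_b1 _) IH) _.
by rewrite add1n addSn.
Qed.

(** Pseudo-division by the minimal relations of the dependent variables shows
  that, away from the zeros of their leading coefficients, the differentials of
  these relations generate those of the whole ideal. *)
Lemma grad_span_ndep V s (I := vanishing V) : is_prime I ->
  exists c, ~ I c /\ exists2 qs, size qs = ndep I s &
    forall f y, I f -> @polys_in K N s f -> V y -> ev y c != 0 ->
      (grad y f <= grad_span qs y)%MS.
Proof.
move=> prI; have idI := ideal_vanishing V; rewrite -/I in idI.
elim: s => [|j s [c [Ic [qs sqs IH]]]] /=.
  exists 1; split; first by case: prI.
  exists [::] => // f y _ [a _ <-] _ _; rewrite (_ : grad _ _ = 0) ?sub0mx//.
  by apply/rowP => i; rewrite !mxE mderivC meval0.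
have subS := @subring_polys_in K N s.
have span P y qs' : (forall q, (grad y q <= grad_span qs y)%MS ->
      (grad y q <= grad_span qs' y)%MS) -> coefs_in (@polys_in K N s) P ->
    (forall k, I P`_k) -> V y -> ev y c != 0 ->
    (grad y P.[var K j] <= grad_span qs' y)%MS.
  move=> qq' PS PI Vy cy; rewrite horner_coef grad_sum; apply: summx_sub => k _.
  rewrite gradM (PI k y Vy) scale0r addr0 scalemx_sub// qq'//.
  exact: IH (PI k) (PS k) Vy cy.
have [dep|ndp] := pselect (dependent (@polys_in K N s) I (var K j)); last first.
  exists c; split => //; exists qs.
    by rewrite sqs; case: asboolP.
  move=> f y If [P PS Pf]; move: If; rewrite -Pf => IP Vy cy; apply: span => //.
  exact (independent_coefs subS idI ndp PS IP).
have [Q [Q1 Q2 Q3 Q4 Q5]] := minimal_relation subS idI dep.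
have Q0 : Q != 0 by rewrite -size_poly_gt0 ltnW.
exists (c * lead_coef Q); split; first by case/(proj2 prI).
exists (Q.[var K j] :: qs); first by rewrite /= sqs; case: asboolP.
move=> f y If [P PS Pf]; move: If; rewrite -Pf => IP Vy; rewrite mevalM mulf_eq0 negb_or => /andP [cy ly].
have [k [B [Rm [hB hR sR eqn]]]] := pseudo_division subS PS Q1 Q0.
have eqx : lead_coef Q ^+ k * P.[var K j] = B.[var K j] * Q.[var K j] + Rm.[var K j].
  by rewrite -hornerZ eqn hornerD hornerM.
have IR : I Rm.[var K j].
  have -> : Rm.[var K j] = lead_coef Q ^+ k * P.[var K j] - B.[var K j] * Q.[var K j].
    by rewrite eqx addrC addKr.
  by case: (idI) => _ _ IM; apply: (idealB idI); apply: IM.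
have := congr1 (grad y) eqx.
rewrite gradM (IP y Vy) scale0r add0r meval_exp gradD gradM (Q4 y Vy) scale0r add0r.
move=> eqg; have -> : grad y P.[var K j] =
   (ev y (lead_coef Q) ^+ k)^-1 *: (ev y B.[var K j] *: grad y Q.[var K j] + grad y Rm.[var K j]).
  by rewrite -eqg scalerA mulVf ?scale1r// expf_neq0.
apply: scalemx_sub; apply: addmx_sub.
  by rewrite scalemx_sub// grad_span_cons addsmxSl.
apply: span => // [q hq|]; last exact: Q5.
by rewrite grad_span_cons (submx_trans hq)// addsmxSr.
Qed.

(** The ideal being prime, some point of [V] avoids the zeros both of a minor of
  size N - d and of the leading coefficients of the relations; there the gradients
  of these relations span a space of dimension at least N - d. *)
Lemma codim_ndep V d s : irreducible_variety V -> variety_dim V d ->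
  (forall j, j \in s) -> (N - d <= ndep (vanishing V) s)%N.
Proof.
move=> irr [dN [y0 Vy0 [k [P [gP rP]]]] _] alls.
have prI := prime_vanishing irr.
have [c [Ic [qs sqs hqs]]] := grad_span_ndep s prI.
have [L [Rt h0]] := exists_minor (eq_leq (esym rP)).
have : ~ vanishing V (c * minor_poly P L Rt).
  by case/(proj2 prI) => // /(_ _ Vy0) /eqP; rewrite (negbTE h0).
case/not_vanishing => y Vy; rewrite mevalM mulf_eq0 negb_or ev_minor_poly.
case/andP=> cy /det_neq0_rank /leq_trans; apply; rewrite -sqs.
apply: leq_trans (rank_grad_span qs y); rewrite -mxrank_tr; apply: mxrankS.
apply/row_subP => j; rewrite row_Dmx; apply: hqs => //.
  exact: generator_vanishing.
exact: polys_in_full.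
Qed.

Lemma ndep0 (I : set A) s : is_ideal I -> uniq s ->
  (forall f, @polys_in K N s f -> I f -> f = 0) -> ndep I s = 0%N.
Proof.
move=> idI; elim: s => //= j s IH /andP [js us] h; rewrite IH// => [|f sf].
  rewrite addn0; case: asboolP => // -[P [PS P1 lP Px]].
  have P0 : P = 0.
    apply: (polys_in_transcendental js PS); apply: h => //.
    by exists P.
  by move: P1; rewrite P0 size_poly0.
exact/h/polys_in_cons.
Qed.

Let others s := [seq j <- enum 'I_N | j \notin s].

Lemma mem_others s j : j \in others s ++ s.
Proof. by rewrite mem_cat mem_filter mem_enum andbT; case: (j \in s). Qed.

Lemma size_others s : uniq s -> (size (others s) + size s)%N = N.
Proof.
move=> us; rewrite -size_cat -[RHS]card_ord cardE.
apply/perm_size/uniq_perm; last by move=> j; rewrite mem_others mem_enum.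
  rewrite cat_uniq us filter_uniq ?enum_uniq//= andbT.
  by apply/hasPn => j js; rewrite mem_filter js.
exact: enum_uniq.
Qed.

(** Only the variables outside of [s] can be dependent, and there are at least
  N - d dependent variables. *)
Lemma independent_le_dim V d s : irreducible_variety V -> variety_dim V d ->
  uniq s -> (forall f, @polys_in K N s f -> vanishing V f -> f = 0) ->
  (size s <= d)%N.
Proof.
move=> irr dV us hs; have := codim_ndep irr dV (mem_others s).
have := ndep_cat (vanishing V) (others s) s.
rewrite (ndep0 (ideal_vanishing V) us hs) addn0 => h1 h2.
have := leq_trans h2 h1; rewrite leq_subLR => h; rewrite -(leq_add2l (size (others s))) (size_others us).
by rewrite addnC.
Qed.

(** The variables of [s] form a transcendence basis modulo the prime ideal of
  [V]: every other variable is algebraic over them. An element of [J] outside of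
  this prime ideal can then be moved down to K[s], one variable at a time, by
  [ideal_contraction]. *)
Lemma ideal_eq_of_dim V d s J : irreducible_variety V -> variety_dim V d ->
  uniq s -> size s = d -> is_ideal J -> vanishing V `<=` J ->
  (forall f, @polys_in K N s f -> J f -> f = 0) -> J `<=` vanishing V.
Proof.
move=> irr dV us ss idJ IJ hs; pose I := vanishing V.
have idI : is_ideal I := ideal_vanishing V.
have prI : is_prime I := prime_vanishing irr.
have nd0 : ndep I s = 0%N by apply: ndep0 => // f sf If; apply: hs => //; apply: IJ.
have full : (size (others s) <= ndep I (others s ++ s))%N.
  apply: leq_trans (codim_ndep irr dV (mem_others s)).
  rewrite -(leq_add2r d) subnK; last by case: dV.
  by rewrite -ss size_others.
have contract t : (size t <= ndep I (t ++ s))%N ->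
    (exists2 f, @polys_in K N (t ++ s) f & J f /\ ~ I f) ->
    exists2 f, @polys_in K N s f & J f /\ ~ I f.
  elim: t => //= j t IH; have := ndep_cat I t s; rewrite nd0.
  case: asboolP => [dep|_]; last by move=> h1 h2; exfalso; lia.
  rewrite add1n ltnS => _ ht h; apply: IH ht _.
  exact: (ideal_contraction (subring_polys_in K (t ++ s)) idI prI dep idJ IJ h).
move=> f Jf; apply: contrapT => If.
have [|g sg [Jg]] := contract _ full.
  by exists f => //; apply: polys_in_full; apply: mem_others.
by rewrite (hs _ sg Jg) => -[]; case: idI.
Qed.

End Dimension.

(** * Tangent directions at a smooth point *)

Section TangentFields.
Variables (K : numFieldType) (N : nat).
Local Notation A := (mpoly N K).
Implicit Types (f g : A) (y t u : 'rV[K]_N) (V : set 'rV[K]_N).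

(** A nonzero minor of maximal size makes the chosen combinations of generators
  span all differentials, since no rank on [V] exceeds [r]. *)
Lemma minor_span V k (P : 'I_k -> A) r (L : 'M[K]_(r, N)) (Rt : 'M[K]_(k, r)) y :
  (\rank (Dmx P y) <= r)%N -> ev y (minor_poly P L Rt) != 0 ->
  ((Dmx P y)^T <= (Dmx P y *m Rt)^T)%MS.
Proof.
rewrite ev_minor_poly => Dr h.
have le : ((Dmx P y *m Rt)^T <= (Dmx P y)^T)%MS by rewrite trmx_mul submxMl.
have [_ <-] := mxrank_leqif_sup le.
rewrite eqn_leq (mxrankS le) /= !mxrank_tr (leq_trans Dr)//.
apply: (@det_neq0_rank _ _ _ _ L _ 1%:M); rewrite mulmx1 mulmxA //.
Qed.

(** Cramer's rule turns a tangent vector [t] into the polynomial vector field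
  [X] = delta t - t D R adj(L D R) L, which annihilates the columns of [D R]
  identically and hence, on [V], wherever delta is nonzero, all columns of [D].
  Multiplying it by delta once more removes the exception. *)
Lemma tangent_field V k (P : 'I_k -> A) r y0 t :
  ideal_generators V P -> (forall y, V y -> (\rank (Dmx P y) <= r)%N) ->
  V y0 -> \rank (Dmx P y0) = r -> t *m Dmx P y0 = 0 ->
  exists (Y : 'rV[A]_N) (c : K), [/\ c != 0, map_mx (meval (y0 0)) Y = c *: t &
    forall f, vanishing V f -> vanishing V (\sum_i Y 0 i * mderiv i f)].
Proof.
move=> gP rk Vy0 rk0 t0.
have [L [Rt h0]] := exists_minor (eq_leq (esym rk0)).
pose Dp : 'M[A]_(N, k) := \matrix_(i, j) mderiv i (P j).
pose Lp := map_mx (@mpolyC N K) L; pose Rp := map_mx (@mpolyC N K) Rt.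
pose tp := map_mx (@mpolyC N K) t.
pose M := Lp *m Dp *m Rp.
pose X := minor_poly P L Rt *: tp - tp *m (Dp *m Rp) *m \adj M *m Lp.
have evC a b (B : 'M[K]_(a, b)) y : map_mx (meval (y 0)) (map_mx (@mpolyC N K) B) = B.
  by apply/matrixP => i j; rewrite !mxE; exact: mevalC.
have evD y : map_mx (meval (y 0)) Dp = Dmx P y by apply/matrixP => i j; rewrite !mxE.
have XDR : X *m (Dp *m Rp) = 0.
  rewrite mulmxBl -scalemxAl -!mulmxA (mulmxA Lp) -/M.
  by rewrite mul_adj_mx !mulmxA mul_mx_scalar subrr.
have evXD y : map_mx (meval (y 0)) X *m (Dmx P y *m Rt) = 0.
  have := congr1 (map_mx (meval (y 0))) XDR.
  by rewrite !map_mxM evD evC map_mx0.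
exists (minor_poly P L Rt *: X), (ev y0 (minor_poly P L Rt) ^+ 2); split.
- by rewrite expf_neq0.
- rewrite map_mxZ map_mxB map_mxZ !map_mxM !evC evD.
  by rewrite (mulmxA t) t0 !mul0mx subr0 scalerA expr2.
move=> f If y Vy.
have -> : ev y (\sum_i (minor_poly P L Rt *: X) 0 i * mderiv i f) =
   ev y (minor_poly P L Rt) * (map_mx (meval (y 0)) X *m (grad y f)^T) 0 0.
  rewrite meval_sum mxE mulr_sumr; apply: eq_bigr => i _.
  by rewrite !mevalM !mxE mevalM mulrA.
have [->|h] := eqVneq (ev y (minor_poly P L Rt)) 0; first by rewrite mul0r.
have /submxP [w ->] := submx_trans (grad_sub_Dmx gP Vy If) (minor_span V (rk y Vy) h).
by rewrite trmx_mul trmxK mulmxA evXD mul0mx mxE mulr0.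
Qed.

(** Coordinates complementary to independent rows of [D(V)(y0)] are local
  coordinates: no nonzero differential of an element of the ideal involves them
  alone. *)
Lemma local_coordinates V k (P : 'I_k -> A) r y0 :
  ideal_generators V P -> (forall y, V y -> (\rank (Dmx P y) <= r)%N) ->
  V y0 -> \rank (Dmx P y0) = r ->
  exists (s : seq 'I_N) (h : A), [/\ uniq s, size s = (N - r)%N, ev y0 h != 0 &
    forall y u, V y -> ev y h != 0 -> (u <= (Dmx P y)^T)%MS ->
      (forall i, i \notin s -> u 0 i = 0) -> u = 0].
Proof.
move=> gP rk Vy0 rk0.
pose ix := maxrankfun (Dmx P y0).
pose s := [seq i <- enum 'I_N | i \notin codom ix].
pose L : 'M[K]__ := rowsub ix 1%:M.
have /row_freeP [Rt LR] := maxrowsub_free (Dmx P y0).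
have LDR : L *m Dmx P y0 *m Rt = 1%:M by rewrite -LR mul_rowsub_mx mul1mx.
exists s, (minor_poly P L Rt); split.
- by rewrite filter_uniq ?enum_uniq.
- have e : (\rank (Dmx P y0) + size s = N)%N.
    rewrite -[RHS]card_ord -(cardC (mem (codom ix))) card_codom ?card_ord//; last exact: maxrankfun_inj.
    by congr (_ + _)%N; rewrite cardE /enum_mem size_filter -size_filter /s enumT.
  by apply: (@addnI r); rewrite subnKC -?rk0 ?rank_leq_row.
- by rewrite ev_minor_poly LDR det1 oner_eq0.
move=> y u Vy h uD us.
have rky : (\rank (Dmx P y) <= \rank (Dmx P y0))%N by rewrite rk0; apply: rk.
have /submxP [w uw] := submx_trans uD (minor_span V rky h).
have uL : u *m L^T = 0.
  apply/rowP => j; rewrite !mxE (bigD1 (ix j)) //= us ?mul0r ?add0r.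
    by rewrite big1 // => i ij; rewrite !mxE eq_sym (negbTE ij) mulr0.
  by rewrite mem_filter codom_f.
have : w *m (L *m Dmx P y *m Rt)^T = 0.
  by rewrite -mulmxA trmx_mul mulmxA -uw uL.
have unitM : (L *m Dmx P y *m Rt)^T \in unitmx.
  by rewrite unitmx_tr unitmxE unitfE -ev_minor_poly.
by move/(congr1 (mulmx^~ (invmx (L *m Dmx P y *m Rt)^T))); rewrite mulmxK// mul0mx uw => ->; rewrite mul0mx.
Qed.

(** In characteristic zero, repeated differentiation turns a nonzero polynomial
  into a nonzero constant. [T] restricts the polynomials considered, for instance
  to those in some of the variables. *)
Lemma vanishing_of_derivatives (T : set A) (Z : set 'rV[K]_N) : Z !=set0 ->
  (forall f i, T f -> vanishing Z f -> T (mderiv i f) /\ vanishing Z (mderiv i f)) ->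
  forall f, T f -> vanishing Z f -> f = 0.
Proof.
move=> [z Zz] hT f; have [b] := ubnP (msize f); elim: b f => // b IH f fb Tf Zf.
have d0 i : mderiv i f = 0.
  have [Ti Zi] := hT f i Tf Zf.
  have [f0|f0] := eqVneq f 0; first by rewrite f0 mderiv0.
  apply: IH => //; apply: (@leq_trans (msize f)); last by rewrite -ltnS.
  rewrite -(mlead_deg f0) ltnS msizeE; apply/bigmax_leqP_seq => m mi _.
  have : mnm_add m (mnm1 i) \in msupp f.
    move: mi; rewrite !mcoeff_msupp mcoeff_deriv; apply: contra_neq => ->.
    by rewrite mul0rn.
  by move/msize_mdeg_lt; rewrite mdegD mdeg1 addn1 -(mlead_deg f0) ltnS.
have fC : f = mpolyC N (mcoeff mnm0 f).
  apply/mpolyP => m; rewrite mcoeffC.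
  have [->|m0] := eqVneq m (mnm0 : multinom N); first by rewrite mulr1.
  rewrite mulr0; have [i mi] : exists i, m i != 0%N.
    apply: contrapT => h; case/eqP: m0; apply/mnmP => i; rewrite mnmE.
    by apply/eqP/negPn/negP => mi; apply: h; exists i.
  have := congr1 (mcoeff (mnm_sub m (mnm1 i))) (d0 i).
  rewrite mcoeff_deriv mcoeff0 submK; last first.
    by apply/mnm_lepP => j; rewrite mnm1E; case: eqP => // <-; rewrite lt0n.
  by move/eqP; rewrite mulrn_eq0 /= => /eqP.
by move: (Zf z Zz); rewrite fC mevalC => ->; rewrite mpolyC0.
Qed.

End TangentFields.

Lemma zariski_closure_algebraic (K : fieldType) N (V : set 'rV[K]_N) :
  algebraic V -> zariski_closure V `<=` V.
Proof. by move=> [F ->] z h f Ff; apply: h => w; apply. Qed.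

(** * Complexification *)

Section Complexify.
Variables (R : realType) (N : nat).
Implicit Types (a b : mpoly N R) (y : 'rV[R]_N) (C : set 'rV[R]_N).
Local Notation cpoly := (map_mpoly (real_complex R)).

Lemma ev_cpoly y a : ev (cplx y) (cpoly a) = real_complex R (ev y a).
Proof.
elim/mpolyind: a => [|c m a _ _ IH]; first by rewrite rmorph0 !meval0 rmorph0.
rewrite rmorphD /= map_mpolyZ map_mpolyX !mevalD !mevalZ !mevalX IH rmorphD rmorphM.
congr (_ * _ + _); rewrite rmorph_prod; apply: eq_bigr => i _.
by rewrite rmorphXn mxE.
Qed.

Lemma mderiv_cpoly i a : mderiv i (cpoly a) = cpoly (mderiv i a).
Proof.
by apply/mpolyP => m; rewrite mcoeff_map_mpoly !mcoeff_deriv mcoeff_map_mpoly raddfMn.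
Qed.

Lemma cpoly_split (f : mpoly N R[i]) :
  exists a b, f = cpoly a + mpolyC N 'i%C * cpoly b.
Proof.
elim/mpolyind: f => [|[x z] m f _ _ [a [b ->]]].
  by exists 0, 0; rewrite rmorph0 mulr0 addr0.
exists (x *: mpolyX R m + a), (z *: mpolyX R m + b).
rewrite !rmorphD /= !map_mpolyZ !map_mpolyX.
have -> : (x +i* z)%C = real_complex R x + 'i%C * real_complex R z.
  by simpc.
have ringE (A : comPzRingType) (u v w t p q : A) :
    (u + v * w) * t + (p + v * q) = (u * t + p) + v * (w * t + q) by ring.
by rewrite -!mul_mpolyC mpolyCD mpolyCM ringE.
Qed.

Lemma complex_split_eq0 (x z : R) :
  real_complex R x + 'i%C * real_complex R z = 0 -> x = 0 /\ z = 0.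
Proof. by simpc => /eqP; rewrite eq_complex /= => /andP [/eqP -> /eqP ->]. Qed.

Lemma ev_cpoly_split y a b : ev (cplx y) (cpoly a + mpolyC N 'i%C * cpoly b) =
  real_complex R (ev y a) + 'i%C * real_complex R (ev y b).
Proof. by rewrite mevalD ev_cpoly (mevalM _ (mpolyC N 'i%C)) ev_cpoly mevalC. Qed.

Lemma cpoly_split_eq0 a b :
  cpoly a + mpolyC N 'i%C * cpoly b = 0 -> a = 0 /\ b = 0.
Proof.
move=> h; have e m : mcoeff m a = 0 /\ mcoeff m b = 0.
  apply: complex_split_eq0; have := congr1 (mcoeff m) h.
  by rewrite mcoeffD mcoeff_map_mpoly mcoeffCM mcoeff_map_mpoly mcoeff0.
by split; apply/mpolyP => m; rewrite mcoeff0; have [] := e m.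
Qed.

Lemma sub_complexification C y : C y -> complexification C (cplx y).
Proof. by move=> Cy _ [a Ia <-]; rewrite ev_cpoly Ia// rmorph0. Qed.

(** Split [f] into real and imaginary parts: both vanish on [C], so they are among
  the polynomials that define the complexification. *)
Lemma vanishing_complexification C (f : mpoly N R[i]) :
  vanishing (complexification C) f <-> forall y, C y -> ev (cplx y) f = 0.
Proof.
split=> [h y Cy|]; first exact/h/sub_complexification.
have [a [b ->]] := cpoly_split f => h y Cy.
have h' z : C z -> ev z a = 0 /\ ev z b = 0.
  by move=> Cz; apply: complex_split_eq0; rewrite -ev_cpoly_split h.
have ea : ev y (cpoly a) = 0 by apply: Cy; exists a => // z /h' [].
have eb : ev y (cpoly b) = 0 by apply: Cy; exists b => // z /h' [].
by rewrite mevalD ea (mevalM _ (mpolyC N 'i%C)) eb mulr0 addr0.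
Qed.

Lemma vanishing_complexification_split C (f : mpoly N R[i]) :
  vanishing (complexification C) f ->
  exists a b, [/\ f = cpoly a + mpolyC N 'i%C * cpoly b, vanishing C a & vanishing C b].
Proof.
move=> /vanishing_complexification; have [a [b ->]] := cpoly_split f => h.
exists a, b; split => // y /h; rewrite ev_cpoly_split; by case/complex_split_eq0.
Qed.

Lemma vanishing_cpoly C a : vanishing C a -> vanishing (complexification C) (cpoly a).
Proof.
by move=> Ia; apply/vanishing_complexification => y Cy; rewrite ev_cpoly Ia ?rmorph0.
Qed.

Lemma complexification_generators C k (P : 'I_k -> mpoly N R) :
  ideal_generators C P -> ideal_generators (complexification C) (fun j => cpoly (P j)).
Proof.
move=> gP; apply/seteqP; split => f /=; last first.
  have [I0 ID IM] := ideal_vanishing (complexification C).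
  move=> [c ->]; elim/big_ind: _ => // j _; apply/IM/vanishing_cpoly.
  exact: generator_vanishing.
move=> /vanishing_complexification_split [a [b [-> ]]].
rewrite gP => -[c ->] [c' ->].
exists (fun j => cpoly (c j) + mpolyC N 'i%C * cpoly (c' j)).
rewrite !rmorph_sum mulr_sumr -big_split; apply: eq_bigr => j _ /=.
have ringE (A : comPzRingType) (u v p q : A) :
    u * p + v * (q * p) = (u + v * q) * p by ring.
by rewrite !rmorphM ringE.
Qed.

Lemma Dmx_cpoly k (P : 'I_k -> mpoly N R) y :
  Dmx (fun j => cpoly (P j)) (cplx y) = map_mx (real_complex R) (Dmx P y).
Proof. by apply/matrixP => i j; rewrite !mxE mderiv_cpoly ev_cpoly. Qed.

Lemma D_rank_complexification C y r : D_rank C y r ->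
  D_rank (complexification C) (cplx y) r.
Proof.
move=> [k [P [gP rP]]]; exists k, (fun j => cpoly (P j)); split.
  exact: complexification_generators.
by rewrite Dmx_cpoly mxrank_map.
Qed.

(** A nonzero minor of size n - d + 1 somewhere on the complexification would be
  a complex polynomial vanishing at the real points, hence everywhere. *)
Lemma variety_dim_complexification C d : variety_dim C d ->
  variety_dim (complexification C) d.
Proof.
move=> [dN [y0 Cy0 r0] rk]; split => //.
  by exists (cplx y0); [apply: sub_complexification|apply: D_rank_complexification].
move=> z r Cz Dr; have [k [P [gP rP]]] := r0.
have gP' := complexification_generators gP.
rewrite -(D_rankP gP' Cz Dr) leqNgt; apply/negP => /exists_minor [L [Rt]].
move/eqP; apply; apply: (iffRL (vanishing_complexification C _) _ z Cz) => y Cy.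
apply/eqP; rewrite ev_minor_poly; apply/negPn/negP => /det_neq0_rank.
rewrite Dmx_cpoly mxrank_map ltnNge (rk y)//.
by exists k, P.
Qed.

Lemma smooth_complexification C y : smooth_points C y ->
  smooth_points (complexification C) (cplx y).
Proof.
move=> [Cy [d dC Dy]]; split; first exact: sub_complexification.
by exists d; [apply: variety_dim_complexification|apply: D_rank_complexification].
Qed.

Lemma smooth_not_Sing (K : fieldType) (V : set 'rV[K]_N) (y : 'rV[K]_N) :
  (V `\` Sing V) y <-> smooth_points V y.
Proof.
split=> [[Vy h]|[Vy h]]; last by split=> // -[_]; apply.
by apply: contrapT => h'; apply: h.
Qed.

Lemma complexification_real C y : algebraic C -> complexification C (cplx y) -> C y.
Proof.
move=> algC h; apply: (zariski_closure_algebraic algC) => f If.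
have /eqP := h (cpoly f) (ex_intro2 _ _ f If erefl).
by rewrite ev_cpoly fmorph_eq0 => /eqP.
Qed.

End Complexify.

(** * Polynomial functions *)

Section PolynomialFunctions.
Variables (R : realType) (N : nat).
Implicit Types (f : mpoly N R) (y z v : 'rV[R]_N).

Lemma mpoly_ring_ind (P : mpoly N R -> Prop) :
  (forall c, P (mpolyC N c)) -> (forall i, P (var R i)) ->
  (forall f g, P f -> P g -> P (f + g)) -> (forall f g, P f -> P g -> P (f * g)) ->
  forall f, P f.
Proof.
move=> PC PX PD PM f; have := @polys_in_full R N (enum 'I_N) f (mem_enum 'I_N).
elim: (enum 'I_N) f => [f [c _ <-]//|i s IH f [Q Qs <-]].
rewrite horner_coef; elim/big_ind: _ => [||k _].
- by rewrite -mpolyC0.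
- exact: PD.
apply: (PM); first exact/IH/Qs.
elim: (nat_of_ord k) => [|j Pj]; first by rewrite expr0 -mpolyC1.
by rewrite exprS; apply: PM.
Qed.

Lemma continuous_ev f : continuous (fun y : 'rV[R]_N => ev y f).
Proof.
elim/mpoly_ring_ind: f => [c|i|f g IHf IHg|f g IHf IHg] y.
- have -> : (fun y : 'rV[R]_N => ev y (mpolyC N c)) = cst c.
    by apply/funext => z; rewrite mevalC.
  exact: cst_continuous.
- have -> : (fun y : 'rV[R]_N => ev y (var R i)) = (fun y => y 0 i).
    by apply/funext => z; rewrite mevalXU.
  exact: coord_continuous.
- have -> : (fun y : 'rV[R]_N => ev y (f + g)) = (fun y => ev y f) \+ (fun y => ev y g).
    by apply/funext => z; rewrite mevalD.
  by apply: continuousD; [apply: IHf|apply: IHg].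
- have -> : (fun y : 'rV[R]_N => ev y (f * g)) = (fun y => ev y f) \* (fun y => ev y g).
    by apply/funext => z; rewrite mevalM.
  by apply: continuousM; [apply: IHf|apply: IHg].
Qed.

(** Only derivatives along lines are asked for: they are what extremality on a
  segment uses, and they are computed by the rules for functions of one real
  variable. *)
Definition has_gradient (F : 'rV[R]_N -> R) (G : 'rV[R]_N -> 'rV[R]_N) :=
  forall z v s, is_derive (s : R) 1 (fun a => F (z + a *: v))
    ((G (z + s *: v) *m v^T) 0 0).

Lemma has_gradient_ev f : has_gradient (fun y => ev y f) (fun y => grad y f).
Proof.
elim/mpoly_ring_ind: f => [c|i|f g IHf IHg|f g IHf IHg] z v s.
- have -> : (fun a : R => ev (z + a *: v) (mpolyC N c)) = cst c.
    by apply/funext => a; rewrite mevalC.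
  rewrite (_ : grad _ _ = 0) ?mul0mx ?mxE; first exact: is_derive_cst.
  by apply/rowP => i; rewrite !mxE mderivC meval0.
- have -> : (fun a : R => ev (z + a *: v) (var R i)) = (fun a => z 0 i + a * v 0 i).
    by apply/funext => a; rewrite mevalXU !mxE.
  rewrite mxE (bigD1 i) //= big1 => [|j ij].
    rewrite !mxE mderiv_var eqxx meval1 mul1r addr0.
    by apply: is_derive_eq; rewrite add0r mul1r scaler0 add0r [LHS]mulr1.
  by rewrite !mxE mderiv_var (negbTE ij) meval0 mul0r.
- have -> : (fun a : R => ev (z + a *: v) (f + g)) =
     (fun a => ev (z + a *: v) f) \+ (fun a => ev (z + a *: v) g).
    by apply/funext => a; rewrite mevalD.
  by rewrite gradD mulmxDl mxE; apply: is_deriveD.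
- have -> : (fun a : R => ev (z + a *: v) (f * g)) =
     (fun a => ev (z + a *: v) f) * (fun a => ev (z + a *: v) g).
    by apply/funext => a; rewrite mevalM.
  apply: (is_derive_eq (is_deriveM (IHf z v s) (IHg z v s))).
  rewrite gradM mulmxDl -!scalemxAl [RHS]mxE [X in _ = X + _]mxE [X in _ = _ + X]mxE.
  by rewrite addrC.
Qed.

End PolynomialFunctions.

(** * Lagrange multipliers at smooth points *)

Section Lagrange.
Variables (R : realType) (N : nat).
Implicit Types (y z v t : 'rV[R]_N) (V : set 'rV[R]_N).

Lemma closed_sublevel (f : 'rV[R]_N -> R) c : continuous f -> closed [set z | f z <= c].
Proof.
move=> cf; apply: (@closed_comp _ _ f [set x | x <= c]); last exact: closed_le.
by move=> z _; apply: cf.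
Qed.

Lemma closed_superlevel (f : 'rV[R]_N -> R) c : continuous f -> closed [set z | c <= f z].
Proof.
move=> cf; apply: (@closed_comp _ _ f [set x | c <= x]); last exact: closed_ge.
by move=> z _; apply: cf.
Qed.

Lemma continuous_normB y : continuous (fun z : 'rV[R]_N => `|z - y| : R).
Proof.
move=> z; apply: (@continuous_comp _ _ _ (fun z => z - y) (fun z => `|z|)).
  exact: (cvgB (@cvg_id _ _) (cvg_cst y)).
exact: norm_continuous.
Qed.

Lemma compact_ball y (rho : R) : compact [set z | `|z - y| <= rho].
Proof.
apply: bounded_closed_compact; last exact/closed_sublevel/continuous_normB.
exists (rho + `|y|); split; first exact: num_real.
move=> M hM z /= hz; apply: (le_trans _ (ltW hM)).
have -> : z = z - y + y by rewrite subrK.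
by apply: le_trans (ler_normD _ _) _; rewrite lerD2r.
Qed.

Lemma compact_min (f : 'rV[R]_N -> R) (D : set 'rV[R]_N) :
  continuous f -> compact D -> D !=set0 -> exists2 z, D z & forall w, D w -> f z <= f w.
Proof.
move=> cf cD D0; have [|z] := @EVT_min_rV R N f D D0 cD; first exact: continuous_subspaceT.
by rewrite inE => Dz h; exists z => // w Dw; apply: h; rewrite inE.
Qed.

(** For large [K] the minimizer over the ball cannot lie on the sphere. There,
  either [F + Q] exceeds [F y], or [sq] is positive; by compactness [sq] is
  bounded below on the part of the sphere where the first alternative fails, and
  the penalty takes over. *)
Lemma penalty_minimum (F sq Q : 'rV[R]_N -> R) y (rho : R) :
  continuous F -> continuous sq -> continuous Q -> 0 < rho ->
  (forall z, 0 <= sq z) -> sq y = 0 -> Q y = 0 -> (forall z, z != y -> 0 < Q z) ->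
  (forall z, `|z - y| <= rho -> sq z = 0 -> F y <= F z) ->
  exists K z, [/\ 0 <= K, `|z - y| < rho, K * sq z <= F y - F z &
    forall w, `|w - y| <= rho -> F z + K * sq z + Q z <= F w + K * sq w + Q w].
Proof.
move=> cF cs cQ rho0 s0 sy Qy Qpos hmin.
have Q0 z : 0 <= Q z by have [->|/Qpos/ltW//] := eqVneq z y; rewrite Qy.
have cFQ : continuous (fun z => F z + Q z).
  by move=> z; apply: continuousD; [apply: cF|apply: cQ].
pose S1 := [set z | `|z - y| <= rho] `&`
  ([set z | rho <= `|z - y|] `&` [set z | F z + Q z <= F y]).
have cS1 : compact S1.
  apply: compact_closedI; first exact: compact_ball.
  apply: closedI; last exact: closed_sublevel.
  exact/closed_superlevel/continuous_normB.
have [K [K0 hK]] : exists K, 0 <= K /\ forall z, `|z - y| <= rho -> rho <= `|z - y| ->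
    F y < F z + K * sq z + Q z.
  have [S10|S10] := pselect (S1 !=set0); last first.
    exists 0; split=> // z zr rz; rewrite mul0r addr0 ltNge; apply/negP => h.
    by apply: S10; exists z; split => //; split.
  have [a [ar [/= ra Fa]] amin] := compact_min cs cS1 S10.
  have [b _ bmin] := compact_min cFQ cS1 S10.
  have sa : 0 < sq a.
    rewrite lt_neqAle s0 andbT eq_sym; apply/eqP => sa0.
    have ay : a != y.
      apply/eqP => ay; move: ra; rewrite ay subrr normr0 => /le_lt_trans /(_ rho0).
      by rewrite ltxx.
    by have := hmin a ar sa0; have := Qpos a ay; move: Fa; lra.
  (* at a the penalty sq is least and at b the value F + Q is least *)
  exists (`|F y - (F b + Q b)| / sq a + 1 / sq a); split.
    by apply: addr_ge0; apply: divr_ge0 => //; apply: ltW.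
  move=> z zr rz; have [Fz|Fz] := ltP (F y) (F z + Q z).
    apply: (lt_le_trans Fz); rewrite -addrA lerD2l lerDr mulr_ge0//.
    by apply: addr_ge0; apply: divr_ge0 => //; apply: ltW.
  have S1z : S1 z by split => //; split.
  have hb := bmin z S1z; have ha := amin z S1z.
  have hs : `|F y - (F b + Q b)| + 1 <= (`|F y - (F b + Q b)| / sq a + 1 / sq a) * sq z.
    rewrite -mulrDl -mulrA ler_peMr ?addr_ge0//.
    by rewrite mulrC ler_pdivlMr// mul1r.
  by have := ler_norm (F y - (F b + Q b)); lra.
have cP : continuous (fun z => F z + K * sq z + Q z).
  by move=> z; exact: (cvgD (cvgD (cF z) (cvgM (cvg_cst K) (cs z))) (cQ z)).
have yB : [set z | `|z - y| <= rho] y by rewrite /= subrr normr0 ltW.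
have [z zr zmin] := compact_min cP (@compact_ball y rho) (ex_intro _ y yB).
have := zmin y yB; rewrite sy mulr0 Qy !addr0 => Fzy.
exists K, z; split => //.
- rewrite ltNge; apply/negP => /(hK z zr) h.
  by have := lt_le_trans h Fzy; rewrite ltxx.
- by have := Q0 z; move: Fzy; lra.
Qed.

Lemma near_normP (P : set 'rV[R]_N) y : (\forall z \near y, P z) ->
  exists2 rho : R, 0 < rho & forall z, `|z - y| <= rho -> P z.
Proof.
move=> /nbhs_normP [e /= e0 he]; exists (e / 2); first by rewrite divr_gt0.
move=> z zy; apply: he; rewrite /= distrC; apply: le_lt_trans zy _.
by rewrite ltr_pdivrMr// ltr_pMr// ltr1n.
Qed.

Lemma gradient_at_min F G z v (rho : R) : has_gradient F G -> 0 < rho ->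
  (forall w, `|w - z| <= rho -> F z <= F w) -> (G z *m v^T) 0 0 = 0.
Proof.
move=> FG rho0 hmin.
pose e := rho / (`|v| + 1).
have v0 : 0 < `|v| + 1 by apply: (le_lt_trans (normr_ge0 v)); rewrite ltrDl.
have e0 : 0 < e by rewrite divr_gt0.
have zin : (0 : R) \in `]-e, e[ by rewrite in_itv /= oppr_lt0 e0.
have h := @derive1_at_min R (fun a => F (z + a *: v)) (-e) e 0.
have {h} h := h (ltW (lt_trans (_ : -e < 0) e0)) _ zin _.
have := FG z v 0; rewrite scale0r addr0 => hd.
have /(@derive_val _ _ _ _ _ _ _) <- := hd.
apply: derive_val; apply: h => [|t _|t].
- by rewrite oppr_lt0.
- by have [] := FG z v t.
rewrite in_itv /= => /andP [t1 t2]; rewrite scale0r addr0; apply: hmin.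
rewrite addrC addKr normrZ (le_trans (_ : _ <= e * (`|v| + 1)))//; last first.
  by rewrite /e divfK// gt_eqF.
by apply: ler_pM => //; [rewrite ler_norml !ltW|rewrite lerDl].
Qed.

Lemma has_gradientD F G F' G' : has_gradient F G -> has_gradient F' G' ->
  has_gradient (fun z => F z + F' z) (fun z => G z + G' z).
Proof.
move=> h h' z v s; rewrite mulmxDl mxE.
by apply: is_deriveD.
Qed.

Lemma continuous_sum_at (F : 'I_N -> 'rV[R]_N -> R) y :
  (forall i, {for y, continuous (F i)}) ->
  {for y, continuous (fun z => \sum_i F i z)}.
Proof.
move=> h; apply: (@cvg_big R 'I_N +%R 0 xpredT _ _ _ _ F (fun i => F i y)) => [||i _].
- exact: add_continuous.
- exact: nbhs_filter.
- exact: h.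
Qed.

Definition field_derivative (Y : 'rV[mpoly N R]_N) (f : mpoly N R) :=
  \sum_i Y 0 i * mderiv i f.

Lemma ev_field_derivative Y f z :
  ev z (field_derivative Y f) = (grad z f *m (map_mx (meval (z 0)) Y)^T) 0 0.
Proof.
rewrite /field_derivative meval_sum mxE; apply: eq_bigr => i _.
by rewrite mevalM !mxE mulrC.
Qed.

Lemma field_derivativeD Y f g :
  field_derivative Y (f + g) = field_derivative Y f + field_derivative Y g.
Proof.
by rewrite /field_derivative -big_split; apply: eq_bigr => i _; rewrite mderivD mulrDr.
Qed.

Lemma field_derivativeC Y c f :
  field_derivative Y (mpolyC N c * f) = mpolyC N c * field_derivative Y f.
Proof.
rewrite /field_derivative mulr_sumr; apply: eq_bigr => i _.
by rewrite mderiv_mulC mulrCA.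
Qed.

Lemma field_derivative_sum Y (I : Type) (s : seq I) (F : I -> mpoly N R) :
  field_derivative Y (\sum_(i <- s) F i) = \sum_(i <- s) field_derivative Y (F i).
Proof.
apply: (big_morph (field_derivative Y) (field_derivativeD Y)).
by rewrite /field_derivative big1 // => i _; rewrite mderiv0 mulr0.
Qed.

Lemma field_derivative_sqr Y f :
  field_derivative Y (f * f) = (field_derivative Y f * f) *+ 2.
Proof.
rewrite /field_derivative mulr_suml -sumrMnl; apply: eq_bigr => i _.
by rewrite mderivM [f * _]mulrC -mulr2n mulrnAr mulrA.
Qed.

(** Minimize F + K sum P_j^2 + |z - y|^2 near [y]. At the minimizer the derivative
  along a polynomial field with value proportional to [t] at [y] vanishes. The
  field maps the ideal of [V] to itself, so the penalty contributes at most a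
  constant times K sum P_j^2, which is bounded by the small decrease of F. No
  parametrization of [V] near [y] is involved. *)
Lemma lagrange_multipliers V k (P : 'I_k -> mpoly N R) r F G y t :
  algebraic V -> ideal_generators V P ->
  (forall z, V z -> (\rank (Dmx P z) <= r)%N) -> V y -> \rank (Dmx P y) = r ->
  continuous F -> has_gradient F G ->
  (forall i, {for y, continuous (fun z => G z 0 i)}) ->
  (\forall z \near y, V z -> F y <= F z) ->
  t *m Dmx P y = 0 -> G y *m t^T = 0.
Proof.
move=> algV gP rk Vy rky cF FG cG Fmin t0.
have [Y [c [c0 Yy YI]]] := tangent_field gP rk Vy rky t0.
have /choice [a aE] : forall j, exists a : 'I_k -> mpoly N R,
    field_derivative Y (P j) = \sum_l a l * P l.
  move=> j; have : vanishing V (field_derivative Y (P j)).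
    exact/YI/(generator_vanishing j gP).
  by rewrite gP.
pose SQ := \sum_j P j * P j.
pose Q := \sum_(i < N) (var R i - mpolyC N (y 0 i)) * (var R i - mpolyC N (y 0 i)).
(* a polynomial bound for the coefficients a j l, from |a| <= a^2 + 1 *)
pose BB := \sum_j \sum_l (a j l * a j l + 1).
have evSQ z : ev z SQ = \sum_j ev z (P j) ^+ 2.
  by rewrite meval_sum; apply: eq_bigr => j _; rewrite mevalM expr2.
have evQ z : ev z Q = \sum_i (z 0 i - y 0 i) ^+ 2.
  by rewrite meval_sum; apply: eq_bigr => j _; rewrite mevalM mevalB mevalXU mevalC expr2.
have evBB z : ev z BB = \sum_j \sum_l (ev z (a j l) ^+ 2 + 1).
  rewrite meval_sum; apply: eq_bigr => j _; rewrite meval_sum; apply: eq_bigr => l _.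
  by rewrite mevalD mevalM meval1 expr2.
have SQ0 z : 0 <= ev z SQ by rewrite evSQ sumr_ge0// => j _; rewrite sqr_ge0.
have P2SQ z j : ev z (P j) ^+ 2 <= ev z SQ.
  by rewrite evSQ (bigD1 j)//= lerDl sumr_ge0// => l _; rewrite sqr_ge0.
have Ebound z : `|ev z (field_derivative Y SQ)| <= 2 * ev z BB * ev z SQ.
  rewrite field_derivative_sum meval_sum; apply: le_trans (ler_norm_sum _ _ _) _.
  rewrite evBB; have := P2SQ z; have := SQ0 z; move: (ev z SQ) => q q0 Pq.
  rewrite mulr_sumr mulr_suml; apply: ler_sum => j _.
  rewrite field_derivative_sqr aE mulr_suml -sumrMnl meval_sum.
  apply: le_trans (ler_norm_sum _ _ _) _.
  rewrite mulr_sumr mulr_suml; apply: ler_sum => l _.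
  rewrite mevalMn !mevalM.
  have := Pq j; have := Pq l.
  move: (ev z (P j)) (ev z (P l)) (ev z (a j l)) => u v w vq uq.
  have hvu : `|v * u| <= q.
    by have := sqr_ge0 (v - u); have := sqr_ge0 (v + u); rewrite ler_norml; nra.
  have hw : `|w| <= w ^+ 2 + 1.
    by have := sqr_ge0 (w - 1); have := sqr_ge0 (w + 1); rewrite ler_norml; nra.
  rewrite normrMn -(mulrA w) normrM -[leRHS]mulrA -[leLHS]mulr_natl ler_pM2l//.
  exact: ler_pM.
(* the derivative along Y of F + Q, the part free of the penalty *)
pose Psi z := (G z *m (map_mx (meval (z 0)) Y)^T) 0 0 + ev z (field_derivative Y Q).
have cPsi : {for y, continuous Psi}.
  have -> : Psi = (fun z => \sum_i G z 0 i * ev z (Y 0 i) + ev z (field_derivative Y Q)).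
    by apply/funext => z; rewrite /Psi mxE; under eq_bigr => i _ do rewrite !mxE.
  have c1 : {for y, continuous (fun z => \sum_i G z 0 i * ev z (Y 0 i))}.
    apply: continuous_sum_at => i.
    exact: (cvgM (cG i) (@continuous_ev R N (Y 0 i) y)).
  exact: (cvgD c1 (@continuous_ev R N (field_derivative Y Q) y)).
have Psiy : Psi y = c * (G y *m t^T) 0 0.
  rewrite /Psi Yy linearZ -scalemxAr mxE ev_field_derivative.
  rewrite (_ : grad y Q = 0) ?mul0mx ?mxE ?addr0//.
  rewrite grad_sum big1 // => i _; rewrite gradM mevalB mevalXU mevalC subrr !scale0r.
  by rewrite addr0.
apply/rowP => i; rewrite ord1 [RHS]mxE; apply/eqP/negPn/negP => Gt0.
have Psi0 : Psi y != 0 by rewrite Psiy mulf_neq0.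
have aP : 0 < `|Psi y| by rewrite normr_gt0.
pose M := 2 * `|ev y BB| + 1.
have M0 : 0 < M by rewrite /M; have := normr_ge0 (ev y BB); lra.
have : \forall z \near y, [/\ `|Psi z - Psi y| < `|Psi y| / 2, 2 * ev z BB <= M,
    F y - F z < `|Psi y| / (2 * M) & V z -> F y <= F z].
  pose bb (z : 'rV[R]_N) := ev z BB.
  have n1 : \forall z \near y, `|Psi z - Psi y| < `|Psi y| / 2.
    by move/cvgrPdistC_lt: cPsi; apply; rewrite divr_gt0.
  have n2 : \forall z \near y, `|bb z - bb y| < 1 / 2.
    by move/cvgrPdistC_lt: (@continuous_ev R N BB y); apply; rewrite divr_gt0.
  have n3 : \forall z \near y, `|F z - F y| < `|Psi y| / (2 * M).
    by move/cvgrPdistC_lt: (cF y); apply; rewrite divr_gt0// mulr_gt0.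
  near=> z; split.
  - by near: z.
  - have : `|bb z - bb y| < 1 / 2 by near: z.
    by have := ler_norm (ev y BB); rewrite ltr_norml /M /bb; lra.
  - apply: le_lt_trans (ler_norm _) _; rewrite distrC; by near: z.
  - by near: z.
move=> /near_normP [rho rho0 hrho].
have Vzeros z : ev z SQ = 0 -> V z.
  move=> /eqP; rewrite evSQ psumr_eq0 => [|j _]; last exact: sqr_ge0.
  move=> /allP h; have Pz j : ev z (P j) = 0.
    by apply/eqP; rewrite -sqrf_eq0; apply: h; rewrite mem_index_enum.
  apply: (zariski_closure_algebraic algV).
  rewrite /zariski_closure gP => _ [b ->]; rewrite meval_sum big1 // => j _.
  by rewrite mevalM Pz mulr0.
have [||||K [z [K0 zrho KF zmin]]] := @penalty_minimum F (fun z => ev z SQ) (fun z => ev z Q) y rho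
   cF (@continuous_ev R N SQ) (@continuous_ev R N Q) rho0 SQ0.
- by rewrite evSQ big1 // => j _; rewrite (generator_vanishing j gP)// expr0n.
- by rewrite evQ big1 // => j _; rewrite subrr expr0n.
- move=> z zy; rewrite lt_neqAle evQ sumr_ge0 ?andbT; last by move=> j _; apply: sqr_ge0.
  rewrite eq_sym psumr_eq0; last by move=> j _; apply: sqr_ge0.
  apply: contra_neqN zy => /allP h; apply/rowP => j; apply/eqP.
  by rewrite -subr_eq0 -sqrf_eq0; apply: h; rewrite mem_index_enum.
- by move=> z zr /Vzeros Vz; have [_ _ _] := hrho z zr; apply.
have := has_gradientD FG (has_gradient_ev (mpolyC N K * SQ + Q)).
move=> /(@gradient_at_min _ _ z (map_mx (meval (z 0)) Y) (rho - `|z - y|)).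
rewrite subr_gt0 => /(_ zrho); rewrite mulmxDl mxE -ev_field_derivative.
have dK : ev z (field_derivative Y (mpolyC N K * SQ + Q)) =
    K * ev z (field_derivative Y SQ) + ev z (field_derivative Y Q).
  by rewrite field_derivativeD mevalD field_derivativeC mevalM mevalC.
rewrite dK => h.
have {}h : Psi z + K * ev z (field_derivative Y SQ) = 0.
  rewrite -{}h; first by rewrite /Psi; ring.
  move=> w wz; rewrite !mevalD !mevalM !mevalC !addrA; apply: zmin.
  have -> : w - y = (w - z) + (z - y) by rewrite addrA subrK.
  by apply: le_trans (ler_normD _ _) _; rewrite -lerBrDr.
have [h1 h2 h3 _] := hrho z (ltW zrho).
have hE : K * `|ev z (field_derivative Y SQ)| < `|Psi y| / 2.
  apply: (@le_lt_trans _ _ (M * (F y - F z))).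
    apply: (@le_trans _ _ (M * (K * ev z SQ))); last by rewrite ler_wpM2l// ltW.
    rewrite mulrCA; apply: ler_wpM2l => //; apply: le_trans (Ebound z) _.
    by apply: ler_wpM2r.
  by move: h3; rewrite ltr_pdivlMr ?mulr_gt0// => h3; rewrite ltr_pdivlMr//; lra.
have : `|Psi y| < `|Psi y|; last by rewrite ltxx.
have e1 : `|Psi z| = K * `|ev z (field_derivative Y SQ)|.
  have -> : Psi z = - (K * ev z (field_derivative Y SQ)) by lra.
  by rewrite normrN normrM ger0_norm.
have : `|Psi y| <= `|Psi z - Psi y| + `|Psi z|.
  by rewrite distrC; have := ler_normD (Psi y - Psi z) (Psi z); rewrite subrK.
lra.
Unshelve. all: by end_near.
Qed.

End Lagrange.

(** * The function |u|^p *)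

Section AbsPower.
Variable R : realType.
Implicit Types (p q u v t : R).

Definition abspow p u : R := `|u| `^ p.

(** The signed power: [p * sgnpow (p - 1)] is the derivative of [abspow p]. *)
Definition sgnpow q u : R := Num.sg u * `|u| `^ q.

Lemma abspow_ge0 p u : 0 <= abspow p u. Proof. exact: powR_ge0. Qed.

Lemma abspow0 p : 0 < p -> abspow p 0 = 0.
Proof. by move=> p0; rewrite /abspow normr0 powR0// gt_eqF. Qed.

Lemma abspowM p u v : abspow p (u * v) = abspow p u * abspow p v.
Proof. by rewrite /abspow normrM powRM. Qed.

Lemma sgnpow0 q : sgnpow q 0 = 0. Proof. by rewrite /sgnpow sgr0 mul0r. Qed.

Lemma sgnpow_gt0 q u : 0 < u -> sgnpow q u = u `^ q.
Proof. by move=> u0; rewrite /sgnpow gtr0_sg// mul1r gtr0_norm. Qed.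

Lemma sgnpowN q u : sgnpow q (- u) = - sgnpow q u.
Proof. by rewrite /sgnpow sgrN normrN mulNr. Qed.

Lemma continuous_abspow q : 0 < q -> continuous (abspow q).
Proof.
move=> q0 u; have [->|u0] := eqVneq u 0.
  rewrite /continuous_at abspow0//; apply/cvgrPdist_lt => e e0.
  have eq0 : 0 < e `^ q^-1 by rewrite powR_gt0.
  have n0 : \forall v \near (0 : R), `|v| < e `^ q^-1 := @nbhs0_lt R R _ eq0.
  near=> v; rewrite sub0r normrN ger0_norm ?abspow_ge0//.
  have : `|v| < e `^ q^-1 by near: v.
  move=> /(gt0_ltr_powR q0); rewrite -powRrM mulVf ?gt_eqF// powRr1 ?ltW//.
  by apply; rewrite nnegrE// powR_ge0.
apply: (@continuous_comp _ _ _ (fun v : R => `|v|) (fun v => v `^ q)).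
  exact: norm_continuous.
apply: differentiable_continuous; apply/derivable1_diffP.
by apply: derivable_powR; rewrite in_itv /= normr_gt0 u0.
Unshelve. all: by end_near. Qed.

(** The sign jumps at the origin, but the signed power is the difference of the
  powers of the positive and the negative part of [u]. *)
Lemma continuous_sgnpow q : 0 < q -> continuous (sgnpow q).
Proof.
move=> q0.
have -> : sgnpow q = (fun u => abspow q ((u + `|u|) / 2) - abspow q ((u - `|u|) / 2)).
  apply/funext => u; have [u0|u0|->] := ltrgt0P u.
  - rewrite subrr mul0r abspow0// subr0 sgnpow_gt0// /abspow.
    have -> : (u + u) / 2 = u by lra.
    by rewrite gtr0_norm.
  - rewrite subrr mul0r abspow0// sub0r /sgnpow ltr0_sg// mulN1r /abspow.
    by have -> : (u - - u) / 2 = u by lra.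
  - by rewrite sgnpow0 addr0 subr0 subrr.
move=> u.
have cn : `|v| @[v --> u] --> `|u| by exact: norm_continuous.
have c1 : (v + `|v|) / 2 @[v --> u] --> (u + `|u|) / 2.
  exact: (cvgM (cvgD (@cvg_id _ _) cn) (cvg_cst _)).
have c2 : (v - `|v|) / 2 @[v --> u] --> (u - `|u|) / 2.
  exact: (cvgM (cvgB (@cvg_id _ _) cn) (cvg_cst _)).
have h1 : abspow q ((v + `|v|) / 2) @[v --> u] --> abspow q ((u + `|u|) / 2).
  exact: (continuous_cvg _ (@continuous_abspow q q0 _) c1).
have h2 : abspow q ((v - `|v|) / 2) @[v --> u] --> abspow q ((u - `|u|) / 2).
  exact: (continuous_cvg _ (@continuous_abspow q q0 _) c2).
exact: (cvgB h1 h2).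
Qed.

(** At the origin the difference quotient of [abspow p] is [sgnpow (p - 1)], which
  is continuous. *)
Lemma is_derive_abspow p u : 1 < p ->
  is_derive u 1 (abspow p) (p * sgnpow (p - 1) u).
Proof.
move=> p1; have p0 : 0 < p by apply: lt_trans p1.
have q0 : 0 < p - 1 by rewrite subr_gt0.
have [u0|u0|->] := ltrgt0P u.
- apply: (@near_eq_is_derive _ _ _ (fun v => v `^ p)).
    near=> v; rewrite /abspow gtr0_norm//; near: v.
    exact: lt_nbhsr.
  by rewrite sgnpow_gt0//; apply: is_derive1_powR.
- apply: (@near_eq_is_derive _ _ _ ((fun v => v `^ p) \o -%R)).
    near=> v; rewrite /abspow /= ltr0_norm//; near: v.
    exact: lt_nbhsl.
  apply: (is_derive_eq (is_derive1_comp (is_derive1_powR _ _) (is_deriveNid _ _))).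
    by rewrite oppr_gt0.
  rewrite -[u in RHS]opprK sgnpowN sgnpow_gt0 ?oppr_gt0// mulrN.
  by rewrite mulr1 mulrN.
- rewrite sgnpow0 mulr0.
  have h : (fun h : R => h^-1 *: (abspow p (h *: 1 + 0) - abspow p 0)) @ 0^' --> (0 : R).
    have := continuous_sgnpow q0 (x := 0) => /continuous_withinNx.
    rewrite sgnpow0; apply: cvg_trans; apply: near_eq_cvg.
    near=> v; have v0 : v != 0 by near: v; exact: nbhs_dnbhs_neq.
    rewrite abspow0// subr0 addr0 scaler1 /abspow /sgnpow -(mulr_powRB1 (normr_ge0 v) p0).
    rewrite -[RHS]/(v^-1 * (_ * _)) [RHS]mulrA; congr (_ * _).
    by rewrite normrEsg mulrCA mulVf// mulr1.
  by apply: DeriveDef; [apply/cvg_ex; exists 0|apply: cvg_lim].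
Unshelve. all: by end_near. Qed.

Lemma sgnpow_mono q u v : 0 < q -> u < v -> sgnpow q u < sgnpow q v.
Proof.
move=> q0 uv.
have pos a b : 0 <= a -> a < b -> sgnpow q a < sgnpow q b.
  move=> a0 ab; have b0 : 0 < b by apply: le_lt_trans ab.
  rewrite (sgnpow_gt0 _ b0); move: a0; rewrite le_eqVlt => /orP [/eqP <-|a0].
    by rewrite sgnpow0 powR_gt0.
  by rewrite sgnpow_gt0//; apply: gt0_ltr_powR; rewrite ?nnegrE// ltW.
have [u0|u0] := leP 0 u; first exact: pos.
have [v0|v0] := leP v 0.
  by rewrite -ltrN2 -!sgnpowN; apply: pos; rewrite ?oppr_ge0// ltrN2.
apply: (@lt_trans _ _ 0).
  by rewrite -oppr_gt0 -sgnpowN sgnpow_gt0 ?powR_gt0 ?oppr_gt0.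
by rewrite sgnpow_gt0 ?powR_gt0.
Qed.

(** Strict tangent inequality, from the mean value theorem and the monotonicity of
  the derivative. *)
Lemma abspow_tangent p u v : 1 < p -> u != v ->
  p * sgnpow (p - 1) u * (v - u) < abspow p v - abspow p u.
Proof.
move=> p1 uv; have p0 : 0 < p by apply: lt_trans p1.
have q0 : 0 < p - 1 by rewrite subr_gt0.
have mvt a b : a < b -> exists2 c, a < c < b &
    abspow p b - abspow p a = p * sgnpow (p - 1) c * (b - a).
  move=> ab; have [|c] := MVT ab (fun x _ => is_derive_abspow x p1).
    exact/continuous_subspaceT/continuous_abspow.
  by rewrite in_itv /= => cab eq; exists c.
have [lt|gt|eq] := ltgtP u v; last by rewrite eq eqxx in uv.
  have [c /andP [uc _] ->] := mvt u v lt.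
  by rewrite ltr_pM2r ?subr_gt0// ltr_pM2l// sgnpow_mono.
have [c /andP [_ cu] eq] := mvt v u gt.
rewrite -ltrN2 opprB eq -mulrN opprB ltr_pM2r ?subr_gt0// ltr_pM2l//.
exact: sgnpow_mono.
Qed.

Lemma abspow_convex p t u v : 1 < p -> 0 < t < 1 -> u != v ->
  abspow p (t * u + (1 - t) * v) < t * abspow p u + (1 - t) * abspow p v.
Proof.
move=> p1 /andP [t0 t1] uv; set w := t * u + (1 - t) * v.
have wu : w != u.
  rewrite -subr_eq0 (_ : w - u = (1 - t) * (v - u)); last by rewrite /w; ring.
  by apply: mulf_neq0; rewrite subr_eq0; [rewrite gt_eqF|rewrite eq_sym].
have wv : w != v.
  rewrite -subr_eq0 (_ : w - v = t * (u - v)); last by rewrite /w; ring.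
  by apply: mulf_neq0; [rewrite gt_eqF|rewrite subr_eq0].
have h1 := abspow_tangent p1 wu; have h2 := abspow_tangent p1 wv.
have {h1} : t * (p * sgnpow (p - 1) w * (u - w)) < t * (abspow p u - abspow p w).
  by rewrite ltr_pM2l.
have {h2} : (1 - t) * (p * sgnpow (p - 1) w * (v - w)) < (1 - t) * (abspow p v - abspow p w).
  by rewrite ltr_pM2l// subr_gt0.
have : t * (p * sgnpow (p - 1) w * (u - w)) + (1 - t) * (p * sgnpow (p - 1) w * (v - w)) = 0.
  by move: (p * sgnpow (p - 1) w) => a; rewrite /w; ring.
move: (p * _ * (u - w)) (p * _ * (v - w)) => a b; lra.
Qed.

(** The exponent p - 1 = (2m - 2l - 1) / (2l + 1) is a quotient of odd numbers, so
  signs are preserved on both sides. *)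
Lemma sgnpow_odd (m l : nat) u : (l < m)%N ->
  sgnpow ((2 * m)%:R / (2 * l + 1)%:R - 1) u ^+ (2 * l + 1) = u ^+ (2 * m - 2 * l - 1).
Proof.
move=> lm; rewrite /sgnpow exprMn -[`|u| `^ _ ^+ _]powR_mulrn ?powR_ge0// -powRrM.
have l0 : (2 * l + 1)%:R != 0 :> R by rewrite pnatr_eq0 addn1.
have -> : ((2 * m)%:R / (2 * l + 1)%:R - 1) * (2 * l + 1)%:R = (2 * m - 2 * l - 1)%:R :> R.
  rewrite mulrBl divfK// mul1r -natrB; last by lia.
  by congr (_%:R); lia.
rewrite powR_mulrn//.
have [k ->] : exists k, (2 * m - 2 * l - 1 = 2 * k + 1)%N by exists (m - l - 1)%N; lia.
rewrite [u in RHS]numEsg exprMn; congr (_ * _).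
have [u0|u0|->] := ltrgt0P u.
- by rewrite gtr0_sg// !expr1n.
- by rewrite ltr0_sg// !addn1 !exprSr !exprM sqrrN !expr1n.
- by rewrite sgr0 !addn1 !expr0n.
Qed.

End AbsPower.

(** * Smooth points of real varieties *)

Section SmoothPoints.
Variables (R : realType) (N : nat).
Implicit Types (y z t u : 'rV[R]_N) (V : set 'rV[R]_N).

Lemma coord_le_norm y i : `|y 0 i| <= `|y|.
Proof.
rewrite [leRHS]/Num.norm /= mx_normE -[leLHS]nngE num_le.
exact: (le_bigmax _ (fun ij : 'I_1 * 'I_N => `|y ij.1 ij.2|%:nng) (0, i)).
Qed.

Lemma norm_le_coord y (c : R) : 0 <= c -> (forall i, `|y 0 i| <= c) -> `|y| <= c.
Proof.
move=> c0 h; have [e|e] := eqVneq (mx_norm y) 0; first by rewrite [leLHS]e.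
have [[i j] /= yij] := mx_norm_neq0 e.
by rewrite [leLHS]yij ord1.
Qed.

Lemma closed_algebraic V : algebraic V -> closed V.
Proof.
move=> [F ->]; rewrite (_ : zeros F = \bigcap_(f in F) [set z | ev z f = 0]); last first.
  by apply/seteqP; split=> z h f; apply: h.
apply: closed_bigI => f _.
rewrite (_ : [set z | _] = [set z | ev z f <= 0] `&` [set z | 0 <= ev z f]).
  apply: closedI; first exact/closed_sublevel/continuous_ev.
  exact/closed_superlevel/continuous_ev.
apply/seteqP; split=> [z /= ->|z /= [h1 h2]]; first by split.
by apply/eqP; rewrite eq_le h1.
Qed.

Lemma near_ev_neq0 (f : mpoly N R) y : ev y f != 0 ->
  nbhs y [set z : 'rV[R]_N | ev z f != 0].
Proof.
move=> fy; have /cvgrPdist_lt/(_ `|ev y f|) := @continuous_ev R N f y.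
rewrite normr_gt0 => /(_ fy); apply: filterS => z; apply: contraTneq => ->.
by rewrite subr0 ltxx.
Qed.

(** The columns of the cokernel of the transpose of [D] are tangent vectors, and
  membership in its row space is orthogonality to them. *)
Lemma orthogonal_tangent k (D : 'M[R]_(N, k)) u :
  (forall t, t *m D = 0 -> u *m t^T = 0) -> (u <= D^T)%MS.
Proof.
move=> h; rewrite submxE; apply/eqP/rowP => j; rewrite mxE.
have : u *m (row j (cokermx D^T)^T)^T = 0.
  apply: h; apply/eqP; rewrite -row_mul -[D in _ *m D]trmxK -trmx_mul mulmx_coker.
  by rewrite trmx0 row0.
move=> /(congr1 (fun M : 'M_1 => M 0 0)); rewrite !mxE => e.
by rewrite -[RHS]e; apply: eq_bigr => i _; rewrite !mxE.
Qed.

Section FixedVariety.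
Variables (V : set 'rV[R]_N) (d : nat).
Hypothesis dimV : variety_dim V d.

Lemma dim_generators : exists k (P : 'I_k -> mpoly N R),
  [/\ ideal_generators V P, forall y, V y -> (\rank (Dmx P y) <= N - d)%N
    & forall y, smooth_points V y <-> V y /\ \rank (Dmx P y) = (N - d)%N].
Proof.
have [dN [y0 Vy0 [k [P [gP rP]]]] rk] := dimV; exists k, P; split => // y.
  by move=> Vy; apply: (rk y) => //; exists k, P.
split=> [[Vy [e dimVe De]]|[Vy ry]]; last first.
  by split => //; exists d => //; exists k, P.
split => //; have <- : (N - e = N - d)%N; last exact: D_rankP De.
have [_ [z Vz Dz] rk'] := dimVe.
apply/eqP; rewrite eqn_leq (rk z)//=.
by apply: (rk' y0) => //; exists k, P.
Qed.

(** The rank of D(V) is maximal at smooth points and lower semicontinuous. *)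
Lemma near_smooth y : smooth_points V y ->
  \forall z \near y, V z -> smooth_points V z.
Proof.
have [k [P [gP rk smP]]] := dim_generators => /smP [Vy ry].
have [L [Rt h]] := exists_minor (eq_leq (esym ry)).
apply: filterS (near_ev_neq0 h) => z hz Vz; apply/smP; split => //.
apply/eqP; rewrite eqn_leq rk//=; apply: (@det_neq0_rank _ _ _ _ L _ Rt).
by rewrite -ev_minor_poly.
Qed.

Lemma gradient_at_smooth_min k (P : 'I_k -> mpoly N R) F G y :
  algebraic V -> ideal_generators V P -> smooth_points V y ->
  continuous F -> has_gradient F G ->
  (forall i, {for y, continuous (fun z => G z 0 i)}) ->
  (\forall z \near y, V z -> F y <= F z) -> (G y <= (Dmx P y)^T)%MS.
Proof.
move=> algV gP sy cF FG cG ymin.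
have [k' [P' [gP' rk smP]]] := dim_generators; have [Vy ry] := (smP y).1 sy.
apply: submx_trans (Dmx_sub gP' gP Vy); apply: orthogonal_tangent => t t0.
exact: (lagrange_multipliers algV gP' rk Vy ry cF FG cG ymin t0).
Qed.

(** A polynomial that vanishes on [V] near [y] has a local minimum there, so the
  multiplier rule applies to it. *)
Lemma grad_of_local_zero (O : set 'rV[R]_N) f k (P : 'I_k -> mpoly N R) y :
  algebraic V -> ideal_generators V P -> open O -> O y -> smooth_points V y ->
  (forall z, O z -> smooth_points V z -> ev z f = 0) ->
  (grad y f <= (Dmx P y)^T)%MS.
Proof.
move=> algV gP oO Oy sy fO.
apply: (gradient_at_smooth_min (G := fun y => grad y f) algV gP sy
  (@continuous_ev R N f) (has_gradient_ev f)).
  move=> i; rewrite (_ : (fun z => _) = (fun z => ev z (mderiv i f))).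
    exact: continuous_ev.
  by apply/funext => z; rewrite mxE.
have nO : \forall z \near y, O z by exact: open_nbhs_nbhs.
apply: filterS2 nO (near_smooth sy) => z Oz sz Vz.
by rewrite !fO//; apply: sz.
Qed.

(** Take local coordinates at a point of [O]. If [f] involves them alone and
  vanishes on [V] in [O], then its gradient is a normal vector in these
  coordinates, hence zero wherever they remain local coordinates; so the partial
  derivatives of [f] vanish there too, and [f] is zero. *)
Lemma local_transcendence_basis (O : set 'rV[R]_N) : algebraic V ->
  open O -> O `&` smooth_points V !=set0 ->
  exists s : seq 'I_N, [/\ uniq s, size s = d &
    forall f, (forall i, i \notin s -> mderiv i f = 0) ->
      (forall y, O y -> smooth_points V y -> ev y f = 0) -> f = 0].
Proof.
move=> algV oO [y0 [Oy0 sy0]].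
have [k [P [gP rk smP]]] := dim_generators; have [Vy0 ry0] := (smP y0).1 sy0.
have [s [h [us ss h0 hs]]] := local_coordinates gP rk Vy0 ry0.
exists s; split => //; first by rewrite ss subKn//; case: dimV.
move=> f fs fO.
pose O' := O `&` [set z | ev z h != 0].
have oO' : open O'.
  apply: openI => //; rewrite openE => z; exact: near_ev_neq0.
apply: (@vanishing_of_derivatives _ _ [set f | forall i, i \notin s -> mderiv i f = 0]
    (O' `&` smooth_points V)) => //; last by move=> y [[Oy _] sy]; apply: fO.
  by exists y0.
move=> {fs fO}f i fs fO; split=> [j js|y [O'y sy]].
  by rewrite mderiv_comm fs// mderiv0.
have gy : grad y f = 0.
  apply: (hs y) => //; [by case: sy|by case: O'y| |].
    by apply: (grad_of_local_zero algV gP oO' O'y sy) => z O'z sz; apply: fO.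
  by move=> j js; rewrite mxE fs// meval0.
by have /rowP/(_ i) := gy; rewrite !mxE.
Qed.

(** The ideal of the open piece contains that of [V] and meets K[s] trivially, for
  a transcendence basis [s] adapted to the piece; hence the two are equal. *)
Lemma vanishing_open_smooth (O : set 'rV[R]_N) : irreducible_variety V ->
  open O -> O `&` smooth_points V !=set0 ->
  vanishing (O `&` smooth_points V) `<=` vanishing V.
Proof.
move=> irr oO O0; have [algV _ _] := irr.
have [s [us ss hs]] := local_transcendence_basis algV oO O0.
apply: (ideal_eq_of_dim irr dimV us ss (ideal_vanishing _)).
  by move=> f If y [_ [Vy _]]; apply: If.
move=> f fs fO; apply: hs => [i si|y Oy sy]; first exact: polys_in_mderiv fs.
exact: fO.
Qed.

Lemma transcendence_basis : irreducible_variety V ->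
  exists s : seq 'I_N, [/\ uniq s, size s = d &
    forall f, (forall i, i \notin s -> mderiv i f = 0) -> vanishing V f -> f = 0].
Proof.
move=> [algV _ _]; have [dN [y0 Vy0 D0] _] := dimV.
have [|s [us ss hs]] := @local_transcendence_basis setT algV openT.
  by exists y0; split => //; split => //; exists d.
by exists s; split => // f fs If; apply: hs => // y _ [Vy _]; apply: If.
Qed.

End FixedVariety.

(** The partial derivatives vanish on the same ball. *)
Lemma vanishing_near (f : mpoly N R) y0 : nbhs y0 [set y : 'rV[R]_N | ev y f = 0] -> f = 0.
Proof.
move=> /nbhs_normP [e /= e0 he].
pose Z := [set z : 'rV[R]_N | `|y0 - z| < e].
apply: (@vanishing_of_derivatives _ _ setT Z) => //.
  by exists y0; rewrite /Z /= subrr normr0.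
move=> {f he}f i _ fZ; split => // y Zy.
have r0 : 0 < (e - `|y0 - y|) / 2 by rewrite divr_gt0// subr_gt0.
have := @gradient_at_min R N (fun y => ev y f) (fun y => grad y f) y (delta_mx 0 i) _
  (has_gradient_ev f) r0.
have -> : (grad y f *m (delta_mx 0 i : 'rV[R]_N)^T) 0 0 = ev y (mderiv i f).
  rewrite mxE (bigD1 i)//= !mxE !eqxx mulr1 big1 ?addr0// => j ji.
  by rewrite !mxE (negbTE ji) mulr0.
apply => w wy; rewrite !fZ// /Z /=.
have -> : y0 - w = (y0 - y) + (y - w) by rewrite addrA subrK.
apply: le_lt_trans (ler_normD _ _) _; rewrite [`|y - w|]distrC.
move: Zy; rewrite /Z /=; move: wy; lra.
Qed.

End SmoothPoints.

(** * Best approximation in the p-norm *)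

Section BestPApproximation.
Variables (R : realType) (n : nat) (p : R).
Hypothesis p1 : 1 < p.
Implicit Types (x y z v : 'rV[R]_n) (C : set 'rV[R]_n).

Let p0 : 0 < p. Proof. exact: lt_trans p1. Qed.

Definition sumpow x : R := \sum_i abspow p (x 0 i).

Lemma pnormE x : pnorm p x = sumpow x `^ p^-1. Proof. by []. Qed.

Lemma sumpow_ge0 x : 0 <= sumpow x.
Proof. by apply: sumr_ge0 => i _; apply: abspow_ge0. Qed.

Lemma pnorm_le x z : (pnorm p x <= pnorm p z) = (sumpow x <= sumpow z).
Proof.
have pV0 : 0 < p^-1 by rewrite invr_gt0.
apply/idP/idP => [|h]; last first.
  by rewrite !pnormE; apply: ge0_ler_powR; rewrite ?nnegrE ?sumpow_ge0// ltW.
apply: contraTT; rewrite -!ltNge => h; rewrite !pnormE.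
by apply: gt0_ltr_powR; rewrite ?nnegrE ?sumpow_ge0.
Qed.

Lemma best_approxP C x y :
  best_approx (pnorm p) C x y <-> C y /\ forall z, C z -> sumpow (x - y) <= sumpow (x - z).
Proof.
have lb : has_lbound [set pnorm p (x - z) | z in C].
  by exists 0 => _ [w _ <-]; apply: powR_ge0.
have le z : C z -> dist (pnorm p) x C <= pnorm p (x - z).
  by move=> Cz; exact: (ge_inf lb (imageP (fun y => pnorm p (x - y)) Cz)).
split=> [[Cy xy]|[Cy h]]; (split; first exact: Cy).
  move=> z Cz; rewrite -(pnorm_le (x - y) (x - z)) -xy.
  exact: le.
apply/eqP; rewrite eq_le; apply/andP; split.
  exact: le.
apply: lb_le_inf; first by exists (pnorm p (x - y)), y.
by move=> _ [z Cz <-]; rewrite (pnorm_le (x - y) (x - z)); apply: h.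
Qed.

Lemma continuous_sumpow x : continuous (fun y => sumpow (x - y)).
Proof.
move=> y; apply: continuous_sum_at => i.
have c1 : (x - z) 0 i @[z --> y] --> (x - y) 0 i.
  rewrite !mxE; under eq_cvg do rewrite !mxE.
  exact: (cvgB (cvg_cst _) (@coord_continuous _ _ _ 0 i y)).
exact: (continuous_cvg _ (@continuous_abspow _ _ p0 _) c1).
Qed.

Definition sumpow_gradient x y : 'rV[R]_n :=
  \row_i - (p * sgnpow (p - 1) (x 0 i - y 0 i)).

Lemma has_gradient_sumpow x :
  has_gradient (fun y => sumpow (x - y)) (sumpow_gradient x).
Proof.
move=> z v s.
have -> : (fun a => sumpow (x - (z + a *: v))) =
    \sum_i (abspow p \o (fun a : R => (x 0 i - z 0 i) - a * v 0 i)).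
  apply/funext => a; rewrite fct_sumE; apply: eq_bigr => i _ /=.
  by rewrite !mxE; congr abspow; ring.
rewrite mxE; apply: is_derive_sum => i.
have h : is_derive s 1 (fun a : R => (x 0 i - z 0 i) - a * v 0 i) (- v 0 i).
  by apply: is_derive_eq; rewrite scaler0 !add0r mul1r [X in - X]mulr1.
apply: (is_derive_eq (is_derive1_comp (is_derive_abspow _ p1) h)).
rewrite !mxE mulrN mulNr; congr (- (_ * sgnpow _ _ * _)); ring.
Qed.

Lemma continuous_sumpow_gradient x i : continuous (fun y => sumpow_gradient x y 0 i).
Proof.
move=> y; rewrite /continuous_at !mxE; under eq_cvg do rewrite mxE.
have q0 : 0 < p - 1 by rewrite subr_gt0.
have c1 : {for y, continuous (fun z : 'rV[R]_n => x 0 i - z 0 i)}.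
  exact: (cvgB (cvg_cst _) (@coord_continuous _ _ _ 0 i y)).
have c2 : {for y, continuous (fun z : 'rV[R]_n => sgnpow (p - 1) (x 0 i - z 0 i))}.
  exact: (continuous_cvg _ (@continuous_sgnpow _ _ q0 _) c1).
exact: (cvgN (cvgM (cvg_cst p) c2)).
Qed.

Lemma sumpowZ t x : sumpow (t *: x) = abspow p t * sumpow x.
Proof. by rewrite /sumpow mulr_sumr; apply: eq_bigr => i _; rewrite mxE abspowM. Qed.

Lemma sumpowN x : sumpow (- x) = sumpow x.
Proof. by apply: eq_bigr => i _; rewrite mxE /abspow normrN. Qed.

Lemma sumpow_convex t x z : 0 < t < 1 -> x != z ->
  sumpow (t *: x + (1 - t) *: z) < t * sumpow x + (1 - t) * sumpow z.
Proof.
move=> t01 xz; have [i xzi] : exists i, x 0 i != z 0 i.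
  apply: contrapT => h; case/eqP: xz; apply/rowP => i.
  by apply/eqP/negPn/negP => xzi; apply: h; exists i.
rewrite /sumpow !mulr_sumr -big_split /= (bigD1 i)//= [ltRHS](bigD1 i)//=.
apply: ltr_leD; first by rewrite !mxE; apply: abspow_convex.
apply: ler_sum => j _; rewrite !mxE.
have [->|xzj] := eqVneq (x 0 j) (z 0 j); last by apply/ltW/abspow_convex.
by rewrite -!mulrDl addrC subrK !mul1r.
Qed.

Lemma sumpow_lt_norm x (rho : R) : 0 < rho -> sumpow x < abspow p rho -> `|x| <= rho.
Proof.
move=> rho0 h; apply: norm_le_coord => [|i]; first exact: ltW.
have : abspow p (x 0 i) < abspow p rho.
  by apply: le_lt_trans h; rewrite /sumpow (bigD1 i)//= lerDl sumr_ge0// => j _; apply: abspow_ge0.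
apply: contraTT; rewrite -ltNge -leNgt => lt; rewrite /abspow (gtr0_norm rho0).
by apply: ge0_ler_powR; rewrite ?nnegrE//; apply: ltW.
Qed.

(** Points outside of a large ball around [x] are farther from [x] than a given
  point of [C]; inside, compactness applies. *)
Lemma exists_minimizer C x : closed C -> C !=set0 ->
  exists2 y, C y & forall z, C z -> sumpow (x - y) <= sumpow (x - z).
Proof.
move=> clC [y0 Cy0].
pose rho := (sumpow (x - y0) + 1) `^ p^-1.
have s0 := sumpow_ge0 (x - y0).
have rho0 : 0 < rho by rewrite powR_gt0// ltr_wpDl.
have rhoE : abspow p rho = sumpow (x - y0) + 1.
  rewrite /abspow gtr0_norm// -powRrM mulVf ?gt_eqF// powRr1//; lra.
have small z : sumpow (x - z) <= sumpow (x - y0) -> `|z - x| <= rho.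
  move=> h; rewrite distrC; apply: (sumpow_lt_norm rho0); rewrite rhoE.
  by rewrite (le_lt_trans h)// ltrDl.
have cD : compact ([set z | `|z - x| <= rho] `&` C).
  exact: compact_closedI (@compact_ball _ _ _ _) clC.
have Dy0 : ([set z | `|z - x| <= rho] `&` C) y0 by split => //; apply: small.
have [y [_ Cy] ymin] := compact_min (@continuous_sumpow x) cD (ex_intro _ _ Dy0).
exists y => [|z Cz]; first exact: Cy.
have [h|h] := leP (sumpow (x - z)) (sumpow (x - y0)).
  by apply: ymin; split => //; apply: small.
by apply: le_trans (ymin _ Dy0) (ltW h).
Qed.

(** Strict convexity: moving from [x] towards a best approximation [y] makes [y]
  the only best approximation. *)
Lemma unique_minimizer C x y t : C y ->
  (forall z, C z -> sumpow (x - y) <= sumpow (x - z)) -> 0 < t < 1 ->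
  forall z, C z -> sumpow (y + t *: (x - y) - z) <= sumpow (y + t *: (x - y) - y) -> z = y.
Proof.
move=> Cy ymin /andP [t0 t1] z Cz.
set x' := y + t *: (x - y); rewrite (_ : x' - y = t *: (x - y)); last first.
  by rewrite /x' addrC addKr.
pose b := t^-1 *: (x' - z) => h.
(* x - z is a convex combination of x - y and b, both of size at most that of x - y *)
have xz : x - z = (1 - t) *: (x - y) + (1 - (1 - t)) *: b.
  rewrite subKr /b scalerA mulfV ?gt_eqF// scale1r /x' scalerBl scale1r.
  by apply/rowP => i; rewrite !mxE; ring.
have [e|xyb] := eqVneq (x - y) b.
  have : x' - z = t *: (x - y) by rewrite e /b scalerA mulfV ?gt_eqF// scale1r.
  rewrite /x' => e'; apply/eqP; rewrite eq_sym -subr_eq0; apply/eqP.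
  by move: e'; rewrite addrAC -[RHS]add0r => /addIr.
have := ymin z Cz; rewrite xz leNgt => /negP []; apply: (lt_le_trans (sumpow_convex _ xyb)).
  by rewrite subr_gt0 t1 gtrDl oppr_lt0.
have hb : sumpow b <= sumpow (x - y).
  rewrite /b sumpowZ; apply: (@le_trans _ _ (abspow p t^-1 * sumpow (t *: (x - y)))).
    by rewrite ler_wpM2l ?abspow_ge0.
  by rewrite -sumpowZ scalerA mulVf ?gt_eqF// scale1r.
by rewrite subKr mulrBl mul1r -lerBrDl subKr ler_wpM2l// ltW.
Qed.

End BestPApproximation.

(** * The critical point correspondence *)

Section Correspondence.
Variables (R : realType) (n m l d : nat) (C : set 'rV[R]_n).
Hypotheses (lm : (l < m)%N) (C_irr : irreducible_variety C) (C_dim : variety_dim C d).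
Local Notation p := ((2 * m)%:R / (2 * l + 1)%:R : R).
Implicit Types x y z : 'rV[R]_n.

Lemma exponent_gt1 : 1 < p.
Proof. by rewrite ltr_pdivlMr ?ltr0n ?addn1// mul1r ltr_nat; lia. Qed.

Let p1 := exponent_gt1.

Lemma lsubmx_cplx (v : 'rV[R]_(n + n)) : lsubmx (cplx v) = cplx (lsubmx v).
Proof. by apply/rowP => i; rewrite !mxE. Qed.

Lemma rsubmx_cplx (v : 'rV[R]_(n + n)) : rsubmx (cplx v) = cplx (rsubmx v).
Proof. by apply/rowP => i; rewrite !mxE. Qed.

(** By the multiplier rule the vector with entries sgnpow (p - 1) (x_i - y_i),
  which is proportional to the gradient of sum |x_i - y_i|^p, lies in the real
  normal space at [y]; its entrywise power 2l + 1 is the entrywise power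
  2m - 2l - 1 of [x - y]. *)
Lemma minimizer_in_Sigma x y : smooth_points C y ->
  (forall z, C z -> sumpow p (x - y) <= sumpow p (x - z)) ->
  Sigma m l C (cplx (row_mx x y)).
Proof.
move=> sy ymin; have [algC _ _] := C_irr.
have [k [P [gP rk smP]]] := dim_generators C_dim.
have gy : (sumpow_gradient p x y <= (Dmx P y)^T)%MS.
  apply: (gradient_at_smooth_min C_dim algC gP sy (@continuous_sumpow _ _ _ p1 x)
    (has_gradient_sumpow p1 x)).
    by move=> i; apply: continuous_sumpow_gradient p1 _ _ _.
  by apply: (@filterE _ (nbhs y) (nbhs_filter y)) => z; apply: ymin.
pose u : 'rV[R]_n := \row_i sgnpow (p - 1) (x 0 i - y 0 i).
have uy : (u <= (Dmx P y)^T)%MS.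
  have -> : u = (- p^-1) *: sumpow_gradient p x y.
    apply/rowP => i; rewrite !mxE mulrNN mulrA mulVf ?mul1r//.
    by rewrite gt_eqF// (lt_trans ltr01 p1).
  exact: scalemx_sub.
move=> f; apply; rewrite /Sigma1 /= lsubmx_cplx rsubmx_cplx row_mxKl row_mxKr; split.
  exact/smooth_not_Sing/smooth_complexification.
exists (cplx u).
  exists k, (fun j => map_mpoly (real_complex R) (P j)); split.
    exact: complexification_generators.
  by rewrite Dmx_cpoly map_trmx map_submx.
apply/rowP => i; rewrite !mxE -[LHS]rmorphXn /= (sgnpow_odd _ lm).
by rewrite rmorphXn rmorphB.
Qed.

(** A best approximation of [x] is at most as far from [x] as [y0] is, so for [x]
  near [y0] it is near [y0] too, where all points of [C] are smooth. *)
Lemma near_smooth_minimizer y0 : smooth_points C y0 ->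
  \forall x \near y0, exists2 y, smooth_points C y &
    forall z, C z -> sumpow p (x - y) <= sumpow p (x - z).
Proof.
move=> sy0; have [Cy0 _] := sy0; have [algC C0 _] := C_irr.
have [rho rho0 hrho] := near_normP (near_smooth C_dim sy0).
pose r := rho / 2; have r0 : 0 < r by rewrite divr_gt0.
have p0 : 0 < p := lt_trans ltr01 p1.
have rp : 0 < abspow p r by rewrite /abspow powR_gt0// normr_gt0 gt_eqF.
have near1 : \forall x \near y0, sumpow p (y0 - x) < abspow p r.
  have /cvgrPdist_lt/(_ _ rp) := @continuous_sumpow _ _ _ p1 y0 y0.
  have -> : sumpow p (y0 - y0) = 0.
    by rewrite subrr /sumpow big1 // => i _; rewrite mxE abspow0.
  by apply: filterS => x; rewrite sub0r normrN ger0_norm ?sumpow_ge0.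
have near2 : \forall x \near y0, `|x - y0| < r.
  by apply/nbhs_normP; exists r => // x /=; rewrite distrC.
apply: filterS2 near1 near2 => x h1 h2.
have [y Cy ymin] := exists_minimizer p1 x (closed_algebraic algC) C0.
exists y => //; apply: hrho => //.
have h3 : `|x - y| <= r.
  by apply: (sumpow_lt_norm p1) => //; apply: le_lt_trans h1; rewrite -[leRHS]sumpowN opprB; apply: ymin.
have -> : y - y0 = (x - y0) - (x - y) by rewrite opprB [RHS]addrC addrA subrK.
apply: le_trans (ler_normB _ _) _.
by rewrite [leRHS](splitr rho) lerD// ltW.
Qed.

Lemma Omega_in_Sigma v : Omega (pnorm p) C v -> ~ Sing C (rsubmx v) ->
  Sigma m l C (cplx v).
Proof.
move=> [_ /(best_approxP p1) [Cy ymin]] ns.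
rewrite -(hsubmxK v); apply: minimizer_in_Sigma => //.
exact/smooth_not_Sing.
Qed.

(** The projection contains the real points of a neighbourhood of a smooth point. *)
Lemma dominating_of_real_points (S : set 'rV[R[i]]_(n + n)) :
  (forall v, Sigma m l C (cplx v) -> S (cplx v)) -> dominating S.
Proof.
move=> Sreal; apply/seteqP; split => // z _ f fS.
have [_ [y0 Cy0 D0] _] := C_dim.
have sy0 : smooth_points C y0 by split => //; exists d.
have [a [b fab]] := cpoly_split f.
have fx : nbhs y0 [set x : 'rV[R]_n | ev x a = 0 /\ ev x b = 0].
  apply: filterS (near_smooth_minimizer sy0) => x [y sy ymin].
  apply: complex_split_eq0; rewrite -ev_cpoly_split -fab.
  apply: fS; exists (cplx (row_mx x y)); first exact/Sreal/minimizer_in_Sigma.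
  by rewrite lsubmx_cplx row_mxKl.
have a0 : a = 0 by apply: (@vanishing_near _ _ a y0); apply: filterS fx => x [].
have b0 : b = 0 by apply: (@vanishing_near _ _ b y0); apply: filterS fx => x [].
by rewrite fab a0 b0 rmorph0 mulr0 addr0; apply: meval0.
Qed.

Let first_vars : seq 'I_(n + n) := [seq lshift n i | i <- enum 'I_n].

(** A variety of dimension less than n has a nonzero polynomial in the first n
  variables vanishing on it. Finitely many of them cannot contain all pairs of a
  point and its unique smooth best approximation: multiply these polynomials, take
  [x] near a smooth point where the product is nonzero, and move [x] slightly
  towards one of its best approximations. *)
Lemma exists_top_stratum (s : nat) (V : nat -> set 'rV[R]_(n + n)) :
  (forall i, (i < s)%N -> irreducible_variety (V i) /\
     exists2 e, (e < n)%N & variety_dim (V i) e) ->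
  ~ (Omega (pnorm p) C `\` [set v | Sing C (rsubmx v)] `<=` \bigcup_(i < s) V i).
Proof.
move=> hV cover.
have ufv : uniq first_vars by rewrite map_inj_uniq ?enum_uniq//; apply: lshift_inj.
have sfv : size first_vars = n by rewrite size_map size_enum_ord.
have [H [H0 Hfv HV]] : exists H : mpoly (n + n) R, [/\ H != 0, polys_in first_vars H
    & forall i, (i < s)%N -> vanishing (V i) H].
  elim: s hV {cover} => [|s IH] hV.
    exists 1; split => //; first exact: oner_neq0.
    exact: subring1 (subring_polys_in _ _).
  have [|H [H0 Hfv HV]] := IH; first by move=> i si; apply: hV; apply: ltnW.
  have [irr [e en dimV]] := hV s (ltnSn s).
  have [h [h0 hfv hV']] : exists h : mpoly (n + n) R,
      [/\ h != 0, polys_in first_vars h & vanishing (V s) h].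
    apply: contrapT => nh.
    have := independent_le_dim irr dimV ufv; rewrite sfv leqNgt en => h; apply/notF/h.
    move=> f ff fV; apply/eqP/negPn/negP => f0; apply: nh; by exists f.
  exists (h * H); split; first by rewrite mulf_neq0.
    exact: subringM (subring_polys_in _ _) _ _ _ _.
  move=> i; rewrite ltnS leq_eqVlt => /orP [/eqP ->|si] v Vv; rewrite mevalM.
    by rewrite hV' ?mul0r.
  by rewrite (HV i) ?mulr0.
have [_ [y0 Cy0 D0] _] := C_dim.
have sy0 : smooth_points C y0 by split => //; exists d.
have [rho rho0 hrho] := near_normP (near_smooth_minimizer sy0).
pose w0 : 'rV[R]_(n + n) := row_mx y0 0.
have [w wr Hw] : exists2 w : 'rV[R]_(n + n), `|w0 - w| < rho & ev w H != 0.
  apply: contrapT => nw; case/eqP: H0; apply: (@vanishing_near _ _ H w0).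
  have nb : nbhs w0 [set w | `|w0 - w| < rho].
    by apply/(@nbhs_normP R ('rV[R]_(n + n))); exists rho.
  apply: filterS nb => w wr.
  by apply/eqP/negPn/negP => Hw; apply: nw; exists w.
pose x := lsubmx w.
have [|y sy ymin] := hrho x.
  apply: (norm_le_coord (ltW rho0)) => i; rewrite /x !mxE distrC.
  have := coord_le_norm (w0 - w) (lshift n i).
  by rewrite /w0 mxE row_mxEl mxE => /le_trans; apply; apply: ltW.
have fv_eq (v v' : 'rV[R]_(n + n)) : lsubmx v = lsubmx v' -> ev v H = ev v' H.
  move=> vv'; apply: (polys_in_eval Hfv) => _ /mapP [i _ ->].
  by have /rowP/(_ i) := vv'; rewrite !mxE.
pose z0 := row_mx x y; pose dir : 'rV[R]_(n + n) := row_mx (y - x) 0.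
have Hz0 : ev z0 H != 0 by rewrite (fv_eq _ w)// row_mxKl.
have [r r0 hr] := near_normP (near_ev_neq0 Hz0).
pose t := Num.min (1 / 2) (r / (`|dir| + 1)).
have d0 : 0 < `|dir| + 1 by rewrite ltr_wpDl.
have t0 : 0 < t by rewrite lt_min !divr_gt0.
have t1 : t < 1 by rewrite gt_min; apply/orP; left; lra.
have Ht : ev (z0 + t *: dir) H != 0.
  apply: hr; rewrite addrC addKr normrZ gtr0_norm//.
  apply: (@le_trans _ _ (r / (`|dir| + 1) * (`|dir| + 1))).
    by apply: ler_pM => //; [apply: ltW|rewrite ge_min lexx orbT|rewrite lerDl].
  by rewrite divfK// gt_eqF.
have t'01 : 0 < 1 - t < 1 by rewrite subr_gt0 t1 gtrDl oppr_lt0.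
pose x' := y + (1 - t) *: (x - y).
have Cy : C y by case: sy.
have uniqy := unique_minimizer p1 Cy ymin t'01.
have Om : Omega (pnorm p) C (row_mx x' y).
  rewrite /Omega /= row_mxKl row_mxKr; split.
    move=> [z [z' [/(best_approxP p1) [Cz zmin] /(best_approxP p1) [Cz' z'min] ]]].
    by rewrite (uniqy z Cz (zmin y Cy)) (uniqy z' Cz' (z'min y Cy)).
  apply/(best_approxP p1); split => // z Cz; rewrite leNgt; apply/negP => lt.
  by move: (lt); rewrite (uniqy z Cz (ltW lt)) ltxx.
have [|i si Vi] := cover (row_mx x' y).
  split => //=; rewrite row_mxKr => -[_]; exact.
case/eqP: Ht; rewrite (fv_eq _ (row_mx x' y)); first exact: HV Vi.
rewrite row_mxKl linearD linearZ /= !row_mxKl /x'.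
by apply/rowP => j; rewrite !mxE; ring.
Qed.

(** The real points of an open piece of [V] lie in [S] and are Zariski dense in the
  complexification of [V], which is therefore contained in [S]. A real
  transcendence basis for [V] has n elements, stays independent over the complex
  numbers, and is one for [S] as well, so that the inclusion is an equality. *)
Lemma complexification_eq_component (S : set 'rV[R[i]]_(n + n))
    (V : set 'rV[R]_(n + n)) (O : set 'rV[R]_(n + n)) :
  irreducible_variety S -> variety_dim S n ->
  irreducible_variety V -> variety_dim V n ->
  open O -> O `&` smooth_points V !=set0 ->
  (forall v, O v -> smooth_points V v -> S (cplx v)) -> complexification V = S.
Proof.
move=> irrS dimS irrV dimV oO O0 OS.
have [algS _ _] := irrS.
have IS : vanishing S `<=` vanishing (complexification V).
  move=> f fS; have [a [b fab]] := cpoly_split f.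
  have ab v : O v -> smooth_points V v -> ev v a = 0 /\ ev v b = 0.
    move=> Ov sv; apply: complex_split_eq0; rewrite -ev_cpoly_split -fab.
    exact/fS/OS.
  have Va := @vanishing_open_smooth _ _ _ _ dimV _ irrV oO O0 a.
  have Vb := @vanishing_open_smooth _ _ _ _ dimV _ irrV oO O0 b.
  apply/vanishing_complexification => v Vv; rewrite fab ev_cpoly_split.
  rewrite Va ?Vb ?rmorph0 ?mulr0 ?addr0// => w [Ow sw]; by have [] := ab w Ow sw.
have [s [us ss hs]] := transcendence_basis dimV irrV.
have SI : vanishing (complexification V) `<=` vanishing S.
  apply: (ideal_eq_of_dim irrS dimS us ss (ideal_vanishing _) IS) => f fs.
  case/vanishing_complexification_split => a [b [fab Va Vb]].
  have dab i : i \notin s -> mderiv i a = 0 /\ mderiv i b = 0.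
    move=> si; apply: cpoly_split_eq0; rewrite -!mderiv_cpoly -mderiv_mulC -mderivD -fab.
    exact: polys_in_mderiv fs.
  have a0 : a = 0 by apply: hs => // i si; have [] := dab i si.
  have b0 : b = 0 by apply: hs => // i si; have [] := dab i si.
  by rewrite fab a0 b0 rmorph0 mulr0 addr0.
apply/seteqP; split=> z hz.
  by apply: (zariski_closure_algebraic algS) => f /IS; apply.
by move=> _ [a Va <-]; apply: (SI _ (vanishing_cpoly Va)).
Qed.

End Correspondence.

Lemma complexification_inj (R : realType) N (V W : set 'rV[R]_N) :
  algebraic V -> algebraic W -> complexification V = complexification W -> V = W.
Proof.
move=> algV algW e; apply/seteqP; split=> v Vv.
  by apply: complexification_real => //; rewrite -e; apply: sub_complexification.
by apply: complexification_real => //; rewrite e; apply: sub_complexification.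
Qed.

Theorem theorem5p2 (R : realType) (n m l d : nat) (C : set 'rV[R]_n)
    (S1 : set 'rV[R[i]]_(n + n)) (p : R) (g : 'rV[R]_n -> R)
    (lm : (l < m)%N)
    (C_irr : irreducible_variety C)
    (C_dim : variety_dim C d) (d_bounds : (1 <= d < n)%N)
    (S1_comp : irreducible_component (Sigma m l C) S1)
    (S1_dim : variety_dim S1 n)
    (S1_real : forall v : 'rV[R]_(n + n), Sigma m l C (cplx v) -> S1 (cplx v))
    (p_def : p = (2 * m)%:R / (2 * l + 1)%:R)
    (g_def : forall x, g x = pnorm p x `^ p) :
  [/\ [set cplx v | v in Omega (pnorm p) C `&` Sigma_g g C] `<=` S1,
      dominating S1 &
      forall delta, distance_degree (pnorm p) C delta -> proj_degree S1 delta].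
Proof.
have OmS v : Omega (pnorm p) C v -> ~ Sing C (rsubmx v) -> S1 (cplx v).
  by rewrite p_def => Om ns; apply/S1_real/(Omega_in_Sigma lm C_irr C_dim).
split.
- by move=> _ [v [Om [_ ns]] <-]; apply: OmS.
- exact: dominating_of_real_points lm C_irr C_dim _ S1_real.
move=> delta [s [M [k [Theta [V [deg]]]]]].
move=> [[OmE _ strat _] [/andP [kM Ms] dimn dimlt] [Vinj Vrep] degE ->].
have [S1_irr _ _] := S1_comp.
have Vi_irr i : (i < s)%N -> irreducible_variety (V i) by move=> /strat [].
have VS1 i : (i < M)%N -> complexification (V i) = S1.
  move=> iM; have is_ := leq_trans iM Ms.
  have [Th0 _ irrV [O oO ThE]] := strat i is_.
  apply: (complexification_eq_component S1_irr S1_dim irrV (dimn i iM) oO).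
    by rewrite -ThE.
  move=> v Ov sv; have : (Omega (pnorm p) C `\` [set v | Sing C (rsubmx v)]) v.
    by rewrite OmE; exists i => //; rewrite ThE.
  by case=> Om ns; apply: OmS.
have M0 : (0 < M)%N.
  rewrite lt0n; apply/eqP => M0.
  apply: (@exists_top_stratum R n m l d C lm C_irr C_dim s V) => [i si|].
    by split; [apply: Vi_irr|apply: dimlt; rewrite M0].
  rewrite -p_def OmE => v [i si Thv]; exists i => //.
  by have [_ _ _ [O _ ThE]] := strat i si; move: Thv; rewrite ThE => -[_ []].
have k1 : k = 1%N.
  have [j jk _] := Vrep 0%N M0; have k0 : (0 < k)%N := leq_ltn_trans (leq0n j) jk.
  apply/eqP; rewrite eqn_leq k0 andbT leqNgt; apply/negP => k1.
  have alg i : (i < k)%N -> algebraic (V i).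
    by move=> ik; have [] := Vi_irr i (leq_trans ik (leq_trans kM Ms)).
  have : V 0%N = V 1%N.
    by apply: complexification_inj; rewrite ?VS1 ?(leq_trans _ kM)//; apply: alg.
  by move/(Vinj 0%N 1%N k0 k1).
rewrite k1 big_ord1 -(VS1 0%N M0); apply: degE.
by rewrite k1.
Qed.
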